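(* Let $f\colon\mathrm{Max}(\mathbb B_d)\to\mathrm{Max}(\mathbb B_d)$ be an nc map without fixed points. Then the sequence of iterates $f^{\circ n}$ of $f$ converges (uniformly on compact subsets of each level) to the constant function $\zeta$, where $\zeta\in\partial\mathbb B_d$ is the Denjoy–Wolff point of $f_1=f|_{\mathrm{Max}(\mathbb B_d)(1)}$.
   Context: $\mathbb B_d$ is the open Euclidean unit ball of $\mathbb C^d$. $\mathrm{Max}(\mathbb B_d)=\bigsqcup_{n\ge1}\mathrm{Max}(\mathbb B_d)(n)$, where $$\mathrm{Max}(\mathbb B_d)(n)=\Big\{Z=(Z_1,\dots,Z_d)\in M_n(\mathbb C)^d:\ \mathrm{Re}\Big(\sum_{j=1}^d\overline{w_j}Z_j\Big)<I_n\ \ \forall w\in\mathbb C^d,\ \|w\|\le1\Big\},$$ with $\mathrm{Re}(A)=\frac12(A+A^* )$ and $A<I$ meaning $I-A$ is positive definite. Then $\mathrm{Max}(\mathbb B_d)(1)=\mathbb B_d$. An nc map $f$ of $\Omega=\mathrm{Max}(\mathbb B_d)$ to itself is a map with $f(\Omega(n))\subset\Omega(n)$ for all $n$, $f(X\oplus Y)=f(X)\oplus f(Y)$, and $f(S^{-1}XS)=S^{-1}f(X)S$ whenever $X,S^{-1}XS\in\Omega(n)$, $S\in GL_n(\mathbb C)$ (coordinatewise operations). ''Without fixed points'' means $f(X)\neq X$ for all $X$ in all levels. $f^{\circ n}$ is the $n$-fold composition. The constant function $\zeta\in\mathbb C^d$ sends $X$ at level $n$ to $(\zeta_1I_n,\dots,\zeta_dI_n)$.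 The Denjoy–Wolff point of the fixed-point-free holomorphic self-map $f_1$ of $\mathbb B_d$ is the unique $\zeta\in\partial\mathbb B_d$ such that $f_1^{\circ n}\to\zeta$ uniformly on compact subsets of $\mathbb B_d$ (it exists by the classical Denjoy–Wolff theorem for the ball). *)

(* Defs.v *)
From HB Require Import structures.
From mathcomp Require Import all_boot all_order all_algebra.
From mathcomp Require Import spectral complex.
From mathcomp Require Import all_classical all_reals all_analysis.

Import Order.TTheory GRing.Theory Num.Theory.
Import numFieldNormedType.Exports.

Local Open Scope classical_set_scope.
Local Open Scope complex_scope.
Local Open Scope ring_scope.
Local Open Scope sesquilinear_scope.

(* The usual metric topology of the complex numbers, given by the modulus. *)
HB.instance Definition _ (R : realType) :=
  PseudoPointedMetric.copy R[i] (R[i]^o).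

Section Ball.
Context {R : realType} {d : nat}.

Definition enorm (w : 'rV[R[i]]_d) : R[i] :=
  sqrtC (\sum_(j < d) `|w 0 j| ^+ 2).

Definition unit_ball : set 'rV[R[i]]_d := [set z | enorm z < 1].

Definition unit_sphere : set 'rV[R[i]]_d := [set z | enorm z = 1].

Definition iterates_cvg_to_boundary
    (g : 'rV[R[i]]_d -> 'rV[R[i]]_d) (zeta : 'rV[R[i]]_d) : Prop :=
  unit_sphere zeta /\
  forall K : set 'rV[R[i]]_d, compact K -> K `<=` unit_ball ->
    {uniform K, (fun k => iter k g) @ \oo --> (fun=> zeta)}.

(* [unique P x] says that [x] is the one and only point satisfying [P]. *)
Definition denjoy_wolff_point
    (g : 'rV[R[i]]_d -> 'rV[R[i]]_d) (zeta : 'rV[R[i]]_d) : Prop :=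
  unique (iterates_cvg_to_boundary g) zeta.

End Ball.

(* d-tuples of n x n matrices; as a row over the topological space 'M_n it
   carries the product topology. *)
Notation mxtuple R d n := 'rV['M[R[i]]_n]_d.

Section MatrixBall.
Context {R : realType} {d : nat}.

Definition posdefmx {n} (A : 'M[R[i]]_n) : Prop :=
  A \is hermsymmx /\
  forall v : 'cV[R[i]]_n, v != 0 -> 0 < ((v ^t*) *m A *m v) 0 0.

Definition Remx {n} (A : 'M[R[i]]_n) : 'M[R[i]]_n := 2^-1 *: (A + A ^t*).

(* Only the levels 0 < n are meaningful. *)
Definition maxball (n : nat) : set (mxtuple R d n) :=
  [set Z | forall w : 'rV[R[i]]_d, enorm w <= 1 ->
     posdefmx (1%:M - Remx (\sum_(j < d) (w 0 j)^* *: Z 0 j))].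

Definition mxtuple_dsum {m n} (X : mxtuple R d m) (Y : mxtuple R d n) :
    mxtuple R d (m + n) :=
  map2_mx (fun A B => block_mx A 0 0 B) X Y.

Definition mxtuple_conj {n} (S : 'M[R[i]]_n) (X : mxtuple R d n) :
    mxtuple R d n :=
  map_mx (fun A => invmx S *m A *m S) X.

Definition scalar_mxtuple (n : nat) (z : 'rV[R[i]]_d) : mxtuple R d n :=
  map_mx (fun a => a%:M) z.

(* f is total, but only its values on the levels 0 < n of the matrix ball are
   constrained. *)
Definition nc_self_map (f : forall n, mxtuple R d n -> mxtuple R d n) : Prop :=
  [/\ forall n X, (0 < n)%N -> maxball n X -> maxball n (f n X),
      forall m n X Y, (0 < m)%N -> (0 < n)%N -> maxball m X -> maxball n Y ->
        f (m + n)%N (mxtuple_dsum X Y) = mxtuple_dsum (f m X) (f n Y)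
    & forall n S X, (0 < n)%N -> S \in unitmx ->
        maxball n X -> maxball n (mxtuple_conj S X) ->
        f n (mxtuple_conj S X) = mxtuple_conj S (f n X)].

(* f_1 as a map of row vectors, identifying 1 x 1 matrices with scalars. *)
Definition level1 (f : forall n, mxtuple R d n -> mxtuple R d n) :
    'rV[R[i]]_d -> 'rV[R[i]]_d :=
  fun z => map_mx (fun A : 'M[R[i]]_1 => A 0 0) (f 1%N (scalar_mxtuple 1 z)).

End MatrixBall.

(* Main.v *)
Require Import Defs.
From HB Require Import structures.
From mathcomp Require Import all_boot all_order all_algebra.
From mathcomp Require Import spectral complex.
From mathcomp Require Import all_classical all_reals all_analysis.
From mathcomp Require Import ring lra.

Import Order.TTheory GRing.Theory Num.Theory.
Import numFieldNormedType.Exports.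

Local Open Scope classical_set_scope.
Local Open Scope complex_scope.
Local Open Scope ring_scope.
Local Open Scope sesquilinear_scope.

Set Implicit Arguments.
Unset Strict Implicit.
Unset Printing Implicit Defensive.

(* Upper triangular evaluation replaces all complex analysis. If the block
   point [[z, c (w - z)], [0, w]] lies in Max(B_d)(2), then, being similar
   to the direct sum of z and w, it is mapped to [[f z, c (f w - f z)], [0,
   f w]], again in Max(B_d)(2). Membership means c^2 |<w - z, v>|^2 < 4 (1 -
   Re <z, v>) (1 - Re <w, v>) for |v| <= 1, so f_1 preserves the relation "z
   and w are linked with constant c", which plays the role of a bound on an
   invariant distance: it controls the Euclidean distance, has convex balls
   and is strictly improved by damping f_1 towards an interior point.

   Bolzano-Weierstrass then gives fixed points x_t of (1 - t) f_1; without a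
   fixed point of f_1 they accumulate at some zeta in the sphere, and a
   recurrent orbit is impossible (a recurrent orbit is bounded, by Calka's
   argument, and the points linked to its tail form a convex invariant set,
   in which the damped maps give points moved arbitrarily little). Comparing
   s zeta with x_t as t tends to 0 bounds 1 - Re <f_1^k (s zeta), zeta> by a
   multiple of (1 - s)^(1/2), uniformly in k. As orbits are asymptotic to
   each other, f_1^k (0) tends to zeta.

   At level n the same triangular trick with diagonal blocks 0 and X is a
   Harnack inequality for 1 - <f^k, zeta>, forcing the numerical range of
   f^k (X) to shrink to zeta uniformly on compact sets. *)

(** * Inner product and Euclidean norm on [C^m], with real values *)

Section HermitianDot.
Context {R : realType}.
Local Notation C := R[i].

Lemma complex_ReD (x y : C) : complex.Re (x + y) = complex.Re x + complex.Re y.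
Proof. by case: x y => [a b] [c e]. Qed.

Lemma complex_ImD (x y : C) : complex.Im (x + y) = complex.Im x + complex.Im y.
Proof. by case: x y => [a b] [c e]. Qed.

Lemma complex_ReN (x : C) : complex.Re (- x) = - complex.Re x.
Proof. by case: x. Qed.

Lemma complex_ImN (x : C) : complex.Im (- x) = - complex.Im x.
Proof. by case: x. Qed.

Lemma complex_ReZ (a : R) (x : C) : complex.Re (a%:C * x) = a * complex.Re x.
Proof. by case: x => b c /=; rewrite mul0r subr0. Qed.

Lemma complex_ImZ (a : R) (x : C) : complex.Im (a%:C * x) = a * complex.Im x.
Proof. by case: x => b c /=; rewrite mul0r addr0. Qed.

Lemma complex_conjE (x : C) : x^* = (complex.Re x -i* complex.Im x)%C.
Proof. by case: x. Qed.

Lemma conj_real_complex (a : R) : (a%:C)^* = a%:C :> C.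
Proof. by rewrite complex_conjE /= oppr0. Qed.

(** The squared modulus is kept in [R] rather than in [R[i]], so that real arithmetic applies to all
    later estimates. *)
Definition sqmod (x : C) : R := complex.Re x ^+ 2 + complex.Im x ^+ 2.

Lemma sqmodE (x : C) : (sqmod x)%:C = `|x| ^+ 2.
Proof. exact: add_Re2_Im2. Qed.

Lemma sqmod_ge0 (x : C) : 0 <= sqmod x.
Proof. by rewrite addr_ge0 // sqr_ge0. Qed.

Lemma sqmodM (x y : C) : sqmod (x * y) = sqmod x * sqmod y.
Proof. by case: x y => [a b] [c e]; rewrite /sqmod /=; ring. Qed.

Lemma sqmodJ (x : C) : sqmod x^* = sqmod x.
Proof. by rewrite complex_conjE /sqmod /=; ring. Qed.

Lemma sqmod_real (a : R) : sqmod a%:C = a ^+ 2.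
Proof. by rewrite /sqmod /= expr0n addr0. Qed.

Lemma sqr_Re_le_sqmod (x : C) : complex.Re x ^+ 2 <= sqmod x.
Proof. by rewrite /sqmod lerDl sqr_ge0. Qed.

Lemma mulrJ_sqmod (x : C) : x^* * x = (sqmod x)%:C.
Proof. by rewrite sqmodE mulrC -normCK. Qed.

Context {m : nat}.
Implicit Types (x y z v : 'rV[C]_m).

(** Linear in the first argument; [rdot] is then the pairing that defines the matrix ball at level
    1. *)
Definition hdot x y : C := \sum_(j < m) x 0 j * (y 0 j)^*.
Definition rdot x y : R := complex.Re (hdot x y).
Definition normsq x : R := rdot x x.
Definition l2norm x : R := Num.sqrt (normsq x).

Lemma hdotDl x y z : hdot (x + y) z = hdot x z + hdot y z.
Proof. by rewrite -big_split; apply: eq_bigr => j _; rewrite !mxE mulrDl. Qed.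

Lemma hdotZl (a : C) x y : hdot (a *: x) y = a * hdot x y.
Proof. by rewrite mulr_sumr; apply: eq_bigr => j _; rewrite !mxE mulrA. Qed.

Lemma hdotC x y : hdot y x = (hdot x y)^*.
Proof.
rewrite rmorph_sum; apply: eq_bigr => j _.
by rewrite rmorphM /= conjCK mulrC.
Qed.

Lemma hdotNl x y : hdot (- x) y = - hdot x y.
Proof. by rewrite -scaleN1r hdotZl mulN1r. Qed.

Lemma hdotBl x y z : hdot (x - y) z = hdot x z - hdot y z.
Proof. by rewrite hdotDl hdotNl. Qed.

Lemma hdotZr (a : C) x y : hdot x (a *: y) = a^* * hdot x y.
Proof. by rewrite hdotC hdotZl rmorphM /= -hdotC. Qed.

Lemma hdot0l y : hdot 0 y = 0.
Proof. by rewrite /hdot big1 // => j _; rewrite mxE mul0r. Qed.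

Lemma rdotC x y : rdot y x = rdot x y.
Proof. by rewrite /rdot hdotC complex_conjE. Qed.

Lemma rdotDl x y z : rdot (x + y) z = rdot x z + rdot y z.
Proof. by rewrite /rdot hdotDl complex_ReD. Qed.

Lemma rdotNl x y : rdot (- x) y = - rdot x y.
Proof. by rewrite /rdot hdotNl complex_ReN. Qed.

Lemma rdotBl x y z : rdot (x - y) z = rdot x z - rdot y z.
Proof. by rewrite rdotDl rdotNl. Qed.

Lemma rdotZl (a : R) x y : rdot (a%:C *: x) y = a * rdot x y.
Proof. by rewrite /rdot hdotZl complex_ReZ. Qed.

Lemma rdotDr x y z : rdot x (y + z) = rdot x y + rdot x z.
Proof. by rewrite ![rdot x _]rdotC rdotDl. Qed.

Lemma rdotBr x y z : rdot x (y - z) = rdot x y - rdot x z.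
Proof. by rewrite ![rdot x _]rdotC rdotBl. Qed.

Lemma rdotNr x y : rdot x (- y) = - rdot x y.
Proof. by rewrite ![rdot x _]rdotC rdotNl. Qed.

Lemma rdotZr (a : R) x y : rdot x (a%:C *: y) = a * rdot x y.
Proof. by rewrite ![rdot x _]rdotC rdotZl. Qed.

Lemma rdot0l y : rdot 0 y = 0.
Proof. by rewrite /rdot hdot0l. Qed.

Lemma rdot0r y : rdot y 0 = 0.
Proof. by rewrite rdotC rdot0l. Qed.

Lemma normsq_sum x : normsq x = \sum_(j < m) sqmod (x 0 j).
Proof.
rewrite /normsq /rdot (_ : hdot x x = (\sum_(j < m) sqmod (x 0 j))%:C) //.
rewrite rmorph_sum; apply: eq_bigr => j _.
by rewrite -[LHS]normCK -sqmodE.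
Qed.

Lemma hdotxx x : hdot x x = (normsq x)%:C.
Proof.
rewrite normsq_sum rmorph_sum; apply: eq_bigr => j _.
by rewrite -[LHS]normCK -sqmodE.
Qed.

Lemma normsq_ge0 x : 0 <= normsq x.
Proof. by rewrite normsq_sum sumr_ge0 // => j _; exact: sqmod_ge0. Qed.

Lemma sqmod_le_normsq x (j : 'I_m) : sqmod (x 0 j) <= normsq x.
Proof.
rewrite normsq_sum (bigD1 j) //= lerDl sumr_ge0 // => k _; exact: sqmod_ge0.
Qed.

Lemma normsq_eq0 x : normsq x = 0 -> x = 0.
Proof.
move=> x0; apply/rowP => j; rewrite mxE.
have := sqmod_le_normsq x j; rewrite x0 => h.
have /eqP : sqmod (x 0 j) = 0 by apply/le_anti; rewrite h sqmod_ge0.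
rewrite /sqmod paddr_eq0 ?sqr_ge0 // !sqrf_eq0.
by case: (x 0 j) => a b /= /andP[/eqP-> /eqP->].
Qed.

Lemma normsqN x : normsq (- x) = normsq x.
Proof. by rewrite /normsq rdotNl rdotNr opprK. Qed.

Lemma normsqD x y : normsq (x + y) = normsq x + 2 * rdot x y + normsq y.
Proof. by rewrite /normsq !rdotDl !rdotDr [rdot y x]rdotC; ring. Qed.

Lemma normsqB x y : normsq (x - y) = normsq x - 2 * rdot x y + normsq y.
Proof. by rewrite normsqD normsqN rdotNr; ring. Qed.

Lemma normsqZ (a : C) x : normsq (a *: x) = sqmod a * normsq x.
Proof.
rewrite {1}/normsq /rdot hdotZl hdotZr hdotxx mulrA [a * _]mulrC mulrJ_sqmod.
by rewrite complex_ReZ.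
Qed.

Lemma sqr_rdot_le x y : rdot x y ^+ 2 <= sqmod (hdot x y).
Proof. exact: sqr_Re_le_sqmod. Qed.

(** Cauchy-Schwarz. *)
Lemma sqmod_hdot_le x y : sqmod (hdot x y) <= normsq x * normsq y.
Proof.
have [y0|yn0] := eqVneq (normsq y) 0.
  have -> : hdot x y = 0 by rewrite (normsq_eq0 y0) hdotC hdot0l conjC0.
  by rewrite y0 mulr0 /sqmod /= expr0n addr0.
have y_gt0 : 0 < normsq y by rewrite lt0r yn0 normsq_ge0.
set a := hdot x y.
(* This vector is [|y|^2] times the component of [x] orthogonal to [y]; its squared norm is
   [|y|^2 (|x|^2 |y|^2 - |a|^2)]. *)
have := normsq_ge0 ((normsq y)%:C *: x - a *: y).
rewrite normsqB !normsqZ rdotZl sqmod_real.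
have -> : rdot x (a *: y) = sqmod a.
  by rewrite /rdot hdotZr mulrJ_sqmod.
move=> h.
have : 0 <= normsq y * (normsq x * normsq y - sqmod a) by nra.
by rewrite pmulr_rge0 // subr_ge0.
Qed.

Lemma l2norm_ge0 x : 0 <= l2norm x.
Proof. exact: sqrtr_ge0. Qed.

Lemma sqr_l2norm x : l2norm x ^+ 2 = normsq x.
Proof. by rewrite sqr_sqrtr // normsq_ge0. Qed.

Lemma l2norm_le x (a : R) : 0 <= a -> (l2norm x <= a) = (normsq x <= a ^+ 2).
Proof. by move=> a0; rewrite -sqr_l2norm ler_sqr // nnegrE ?l2norm_ge0. Qed.

Lemma l2norm0 : l2norm (0 : 'rV[C]_m) = 0.
Proof. by rewrite /l2norm /normsq rdot0l sqrtr0. Qed.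

Lemma l2norm_eq0 x : l2norm x = 0 -> x = 0.
Proof.
by move=> x0; apply: normsq_eq0; rewrite -sqr_l2norm x0 expr0n.
Qed.

Lemma l2normN x : l2norm (- x) = l2norm x.
Proof. by rewrite /l2norm normsqN. Qed.

Lemma l2distC x y : l2norm (x - y) = l2norm (y - x).
Proof. by rewrite -l2normN opprB. Qed.

Lemma l2normZ (a : R) x : 0 <= a -> l2norm (a%:C *: x) = a * l2norm x.
Proof.
by move=> a0; rewrite /l2norm normsqZ sqmod_real sqrtrM ?sqr_ge0 // sqrtr_sqr ger0_norm.
Qed.

Lemma rdot_le x y : rdot x y <= l2norm x * l2norm y.
Proof.
have h : rdot x y ^+ 2 <= (l2norm x * l2norm y) ^+ 2.
  by rewrite exprMn !sqr_l2norm (le_trans (sqr_rdot_le x y)) ?sqmod_hdot_le.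
apply: le_trans (ler_norm _) _.
by rewrite -(@ler_sqr R) ?nnegrE ?mulr_ge0 ?l2norm_ge0 // real_normK ?num_real.
Qed.

Lemma rdot_le_norm x v : normsq v <= 1 -> rdot x v <= l2norm x.
Proof.
move=> v1; apply: le_trans (rdot_le x v) _.
by rewrite ler_piMr ?l2norm_ge0 // l2norm_le // expr1n.
Qed.

Lemma sqmod_hdot_le_normsq x v : normsq v <= 1 -> sqmod (hdot x v) <= normsq x.
Proof.
move=> v1; apply: le_trans (sqmod_hdot_le x v) _.
by rewrite ler_piMr ?normsq_ge0.
Qed.

Lemma l2normD x y : l2norm (x + y) <= l2norm x + l2norm y.
Proof.
rewrite l2norm_le ?addr_ge0 ?l2norm_ge0 // normsqD sqrrD !sqr_l2norm.
by have := rdot_le x y; rewrite -mulr_natl; lra.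
Qed.

Lemma l2dist_triangle x y z : l2norm (x - z) <= l2norm (x - y) + l2norm (y - z).
Proof. by rewrite -[x - z](subrKA y) l2normD. Qed.

Lemma l2normB_le x y : l2norm x <= l2norm y + l2norm (x - y).
Proof. by rewrite -{1}[x](subrK y) addrC l2normD. Qed.

(** The norming vector [x / |x|]. It turns inequalities quantified over all [v] in the unit ball
    into norm estimates. *)
Lemma exists_rdot_eq_l2norm x : exists v, normsq v <= 1 /\ rdot x v = l2norm x.
Proof.
have [x0|xn0] := eqVneq (l2norm x) 0.
  by exists 0; rewrite x0 /normsq !rdot0r.
exists ((l2norm x)^-1%:C *: x); rewrite normsqZ sqmod_real rdotZr -/(normsq x).
rewrite -sqr_l2norm; split; last by field.
by rewrite -exprMn mulVf // expr1n.
Qed.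

End HermitianDot.

(** * Comparison of the entrywise topology with the Euclidean norm; Bolzano-Weierstrass *)

Section Topology.
Context {R : realType}.
Local Notation C := R[i].

Lemma enormE {m} (x : 'rV[C]_m) : enorm x = (l2norm x)%:C.
Proof.
rewrite /enorm (_ : \sum_(j < m) _ = (l2norm x)%:C ^+ 2).
  by rewrite sqrCK // lecE /= eqxx l2norm_ge0.
rewrite -rmorphXn sqr_l2norm normsq_sum rmorph_sum.
by apply: eq_bigr => j _; rewrite -sqmodE.
Qed.

Lemma gt0_complex (e : C) : 0 < e -> exists2 r : R, 0 < r & e = r%:C.
Proof.
case: e => a b; rewrite ltcE /= => /andP[/eqP-> a0].
by exists a.
Qed.

Lemma ltc_real (a b : R) : (a%:C < b%:C) = (a < b).
Proof. by rewrite ltcE /= eqxx. Qed.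

Lemma lec_real (a b : R) : (a%:C <= b%:C) = (a <= b).
Proof. by rewrite lecE /= eqxx. Qed.

Lemma normc_lt (x : C) (e : R) : 0 <= e -> (`|x| < e%:C) = (sqmod x < e ^+ 2).
Proof.
move=> e0; rewrite -ltc_real sqmodE rmorphXn.
by rewrite ltr_pXn2r // nnegrE ?normr_ge0 // lecE /= eqxx.
Qed.

Lemma ballCE (x y : C) (e : C) : ball x e y = (`|x - y| < e) :> Prop.
Proof. by []. Qed.

Lemma l2norm_le_coord {m} (x : 'rV[C]_m) (e : R) : 0 <= e ->
  (forall j, sqmod (x 0 j) <= e ^+ 2) -> l2norm x <= m%:R * e.
Proof.
move=> e0 h; rewrite l2norm_le ?mulr_ge0 //.
have -> : (m%:R * e) ^+ 2 = m%:R * (m%:R * e ^+ 2) by ring.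
have le_sum : normsq x <= \sum_(j < m) e ^+ 2.
  by rewrite normsq_sum; apply: ler_sum => j _; exact: h.
apply: le_trans le_sum _; rewrite sumr_const card_ord -[e ^+ 2 *+ _]mulr_natl.
case: m x h => [|m] _ _; first by rewrite !mul0r.
by rewrite ler_wpM2l // ler_peMl ?sqr_ge0 // ler1n.
Qed.

Lemma ball_rV_l2norm {m} (x y : 'rV[C]_m) (e : R) : 0 < e ->
  ball x e%:C y -> l2norm (x - y) <= m%:R * e.
Proof.
move=> e0 [_ h]; apply: l2norm_le_coord => [|j]; first exact: ltW.
by have := h 0 j; rewrite ballCE normc_lt ?(ltW e0) // !mxE; exact: ltW.
Qed.

Lemma continuous_complex : continuous (fun p : R * R => (p.1 +i* p.2)%C : C).
Proof.
move=> [a b] U /nbhs_ballP[e /= /gt0_complex[r r0 ->]] eU.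
apply/nbhs_ballP; exists (r / 2) => /=; first by rewrite divr_gt0.
move=> [c d] [/= h1 h2]; apply: eU => /=.
rewrite ballCE normc_lt ?(ltW r0) // /sqmod /=.
rewrite /ball /= in h1 h2.
have h1' : (a - c) ^+ 2 <= (r / 2) ^+ 2.
  by rewrite -(real_normK (num_real (a - c))) ler_sqr ?nnegrE ?divr_ge0 ?(ltW r0) ?(ltW h1).
have h2' : (b - d) ^+ 2 <= (r / 2) ^+ 2.
  by rewrite -(real_normK (num_real (b - d))) ler_sqr ?nnegrE ?divr_ge0 ?(ltW r0) ?(ltW h2).
by nra.
Qed.

(** Compactness of a product of closed squares. The conclusion gives a cluster point instead of a
    convergent subsequence, which is all that is used. *)
Lemma bolzano_weierstrass {m} (x : nat -> 'rV[C]_m) (M : R) :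
  (forall k, normsq (x k) <= M) ->
  exists y, forall e, 0 < e -> forall N, exists2 k, (N <= k)%N & l2norm (x k - y) < e.
Proof.
move=> xM.
have M0 : 0 <= M by apply: le_trans (xM 0%N); exact: normsq_ge0.
(* If [t ^+ 2 <= M] then [|t| <= 1 + M], so no square root is needed. *)
pose I : set R := `[- (1 + M), 1 + M]%classic.
pose box : set C := (fun p : R * R => (p.1 +i* p.2)%C : C) @` (I `*` I).
have box_compact : compact box.
  apply: continuous_compact; first exact/continuous_subspaceT/continuous_complex.
  by apply: compact_setX; exact: segment_compact.
have := @rV_compact C m (fun=> box) (fun=> box_compact).
set K := [set v | _] => K_compact.
have FK : (x @ \oo) K.
  exists 0%N => // k _ /= j.
  have := le_trans (sqmod_le_normsq (x k) j) (xM k).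
  case: (x k ord0 j) => a b; rewrite /sqmod /= => h.
  have bound (t : R) : t ^+ 2 <= M -> I t.
    by rewrite /I /= in_itv /= => tM; apply/andP; split; nra.
  exists (a, b) => //; split => /=; apply: bound.
    by apply: le_trans h; rewrite lerDl sqr_ge0.
  by apply: le_trans h; rewrite lerDr sqr_ge0.
have [y [_ y_cl]] := K_compact (x @ \oo) _ FK.
exists y => e e0 N; pose r := e / (m%:R + 1).
have r0 : 0 < r by rewrite divr_gt0 // ltr_wpDl.
have [||z [/= [k Nk <-] zB]] := y_cl (x @` [set k | (N <= k)%N]) (ball y r%:C).
- by exists N => // k /= Nk; exists k.
- by apply: nbhsx_ballx; rewrite ltc_real.
exists k => //; rewrite l2distC; apply: le_lt_trans (ball_rV_l2norm r0 zB) _.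
by rewrite /r mulrA ltr_pdivrMr ?ltr_wpDl // mulrC ltr_pM2l // ltrDl.
Qed.

End Topology.

(** * The linking relation and its comparison with the Euclidean distance *)

Section LinkedPoints.
Context {R : realType} {d : nat}.
Local Notation C := R[i].
Implicit Types (x y z w v p : 'rV[C]_d) (c e t rho : R) (F : 'rV[C]_d -> 'rV[C]_d).

(** A larger [c] means closer points: [1 / c] plays the role of the distance. The inequality is the
    discriminant condition for a 2 x 2 hermitian form with diagonal [1 - rdot z v],
    [1 - rdot w v]. *)
Definition linked c z w : Prop := forall v, normsq v <= 1 ->
  c ^+ 2 * sqmod (hdot (w - z) v) <= 4 * (1 - rdot z v) * (1 - rdot w v).

(** All that the dynamics in the ball uses about [level1 f]. *)
Definition contractive F : Prop :=
  (forall z, l2norm z < 1 -> l2norm (F z) < 1) /\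
  forall c z w, 0 <= c -> l2norm z < 1 -> l2norm w < 1 ->
    linked c z w -> linked c (F z) (F w).

Lemma contractive_iter F k : contractive F -> contractive (iter k F).
Proof.
move=> [FB FL]; elim: k => [//|k [IB IL]]; split => [z z1|c z w c0 z1 w1 h] /=.
  exact/FB/IB.
by apply: FL; rewrite ?IB //; apply: IL.
Qed.

Lemma rdot_ge_norm x v : normsq v <= 1 -> - l2norm x <= rdot x v.
Proof.
move=> v1; have := @rdot_le_norm _ _ x (- v); rewrite normsqN rdotNr => /(_ v1).
by lra.
Qed.

(** On the ball of radius [rho] both factors on the right are at least [1 - rho]. *)
Lemma linked_of_dist c rho z w : 0 <= c -> rho <= 1 ->
  l2norm z <= rho -> l2norm w <= rho -> c * l2norm (w - z) <= 2 * (1 - rho) ->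
  linked c z w.
Proof.
move=> c0 r1 zr wr h v v1.
have hz := rdot_le_norm z v1; have hw := rdot_le_norm w v1.
have hn := sqmod_hdot_le_normsq (w - z) v1; rewrite -sqr_l2norm in hn.
have cn0 : 0 <= c * l2norm (w - z) by rewrite mulr_ge0 ?l2norm_ge0.
have h2 : (c * l2norm (w - z)) ^+ 2 <= (2 * (1 - rho)) ^+ 2.
  by rewrite ler_sqr ?nnegrE //; lra.
have h3 : c ^+ 2 * sqmod (hdot (w - z) v) <= (c * l2norm (w - z)) ^+ 2.
  by rewrite exprMn ler_wpM2l ?sqr_ge0.
have h4 : (1 - rho) * (1 - rho) <= (1 - rdot z v) * (1 - rdot w v).
  by apply: ler_pM; lra.
by nra.
Qed.

(** Test with the vector norming [w - z]; both factors on the right are at most 2. *)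
Lemma linked_dist c z w : 0 <= c -> l2norm z < 1 -> l2norm w < 1 ->
  linked c z w -> c * l2norm (w - z) <= 4.
Proof.
move=> c0 z1 w1 h; have [v [v1 vE]] := exists_rdot_eq_l2norm (w - z).
have hz := rdot_ge_norm z v1; have hw := rdot_ge_norm w v1.
have hr := sqr_rdot_le (w - z) v; rewrite vE in hr.
have h4 : (1 - rdot z v) * (1 - rdot w v) <= 2 * 2.
  have hz' := rdot_le_norm z v1; have hw' := rdot_le_norm w v1.
  by apply: ler_pM; lra.
have h3 : (c * l2norm (w - z)) ^+ 2 <= 4 ^+ 2.
  rewrite exprMn; apply: le_trans (_ : c ^+ 2 * sqmod (hdot (w - z) v) <= _).
    by rewrite ler_wpM2l ?sqr_ge0.
  by apply: le_trans (h v v1) _; lra.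
by move: h3; rewrite ler_sqr ?nnegrE ?mulr_ge0 ?l2norm_ge0.
Qed.

(** Stands in for Cauchy estimates: link [z] and [w] with the largest constant that [linked_of_dist]
    allows, apply [F], and read the distance off with [linked_dist]. *)
Lemma contractive_lipschitz F rho z w : contractive F -> rho < 1 ->
  l2norm z <= rho -> l2norm w <= rho ->
  l2norm (F w - F z) <= 2 / (1 - rho) * l2norm (w - z).
Proof.
move=> [FB FL] r1 zr wr.
have [n0|nn0] := eqVneq (l2norm (w - z)) 0.
  by rewrite (subr0_eq (l2norm_eq0 n0)) !subrr l2norm0 mulr0.
have n_gt0 : 0 < l2norm (w - z) by rewrite lt0r nn0 l2norm_ge0.
have rho_gt0 : 0 < 1 - rho by lra.
pose c := 2 * (1 - rho) / l2norm (w - z).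
have c_gt0 : 0 < c by rewrite divr_gt0 // mulr_gt0.
have cz : linked c z w.
  by apply: (linked_of_dist (rho := rho)); rewrite ?(ltW c_gt0) ?(ltW r1) // /c divfK.
have z1 := le_lt_trans zr r1; have w1 := le_lt_trans wr r1.
have := linked_dist (ltW c_gt0) (FB _ z1) (FB _ w1) (FL _ _ _ (ltW c_gt0) z1 w1 cz).
rewrite -ler_pdivlMl // => h; apply: le_trans h _.
have rho_neq0 : 1 - rho != 0 by rewrite gt_eqF.
by have -> : c^-1 * 4 = 2 / (1 - rho) * l2norm (w - z) by rewrite /c; field; rewrite rho_neq0.
Qed.

(** Test with the vector norming [w]: as [|w|] tends to 1 the right side of the link tends to 0,
    while the left side stays bounded below. *)
Lemma linked_bound c rho : 0 < c -> rho < 1 -> exists2 rho', rho' < 1 &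
  forall z w, l2norm z <= rho -> l2norm w < 1 -> linked c z w -> l2norm w <= rho'.
Proof.
(* The first entry gives [|w| - rdot z v >= (1 - rho) / 2]; the second contradicts the resulting
   bound [c^2 (1 - rho)^2 / 4 <= 8 (1 - |w|)]. *)
move=> c0 r1; pose m := Num.min ((1 - rho) / 2) (c ^+ 2 * (1 - rho) ^+ 2 / 32).
have m_gt0 : 0 < m.
  have rho_gt0 : 0 < 1 - rho by lra.
  by rewrite /m lt_min !divr_gt0 ?mulr_gt0 ?exprn_gt0.
exists (1 - m); first by lra.
move=> z w zr w1 h; have [v [v1 vE]] := exists_rdot_eq_l2norm w.
have hz := rdot_le_norm z v1; have hz' := rdot_ge_norm z v1.
have hr := sqr_rdot_le (w - z) v; rewrite rdotBl vE in hr.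
rewrite leNgt; apply/negP => hw; have hm : 1 - l2norm w < m by lra.
move: hm; rewrite /m lt_min => /andP[hm1 hm2].
have h1 : ((1 - rho) / 2) ^+ 2 <= (l2norm w - rdot z v) ^+ 2.
  by rewrite ler_sqr ?nnegrE; lra.
have := h v v1; rewrite vE => h2.
have h3 : c ^+ 2 * ((1 - rho) / 2) ^+ 2 <= 4 * (1 - rdot z v) * (1 - l2norm w).
  apply: le_trans h2; rewrite ler_wpM2l ?sqr_ge0 //; exact: le_trans hr.
have h4 : (1 - rdot z v) * (1 - l2norm w) <= 2 * (1 - l2norm w).
  by rewrite ler_wpM2r; lra.
rewrite exprMn in h3.
by lra.
Qed.

Definition damped F t p z : 'rV[C]_d := (1 - t)%:C *: F z + t%:C *: p.

Lemma l2norm_convex t x y : 0 <= t <= 1 ->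
  l2norm ((1 - t)%:C *: x + t%:C *: y) <= (1 - t) * l2norm x + t * l2norm y.
Proof.
move=> /andP[t0 t1]; apply: le_trans (l2normD _ _) _.
by rewrite !l2normZ // subr_ge0.
Qed.

Lemma damped_ball F t p z : contractive F -> 0 <= t <= 1 -> l2norm p < 1 ->
  l2norm z < 1 -> l2norm (damped F t p z) <= (1 - t) + t * l2norm p.
Proof.
move=> [FB _] t01 p1 z1; apply: le_trans (l2norm_convex _ _ t01) _.
by have := FB _ z1; case/andP: t01 => t0 t1; nra.
Qed.

Lemma damped_ball1 F t p z : contractive F -> 0 <= t <= 1 -> l2norm p < 1 ->
  l2norm z < 1 -> l2norm (damped F t p z) < 1.
Proof.
move=> [FB _] t01 p1 z1; apply: le_lt_trans (l2norm_convex _ _ t01) _.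
have Fz1 := FB _ z1; case/andP: t01 => t0 t1.
have tp : 0 <= t * (1 - l2norm p) by rewrite mulr_ge0 // subr_ge0 ltW.
(* Strictness comes from [F z] unless [t = 1], when it comes from [p]. *)
have [t_lt1|t_ge1] := ltrP t 1; last first.
  have t_eq1 : t = 1 by lra.
  by rewrite t_eq1; lra.
have tF : 0 < (1 - t) * (1 - l2norm (F z)) by rewrite mulr_gt0 // subr_gt0.
by lra.
Qed.

(* The numbers [1 - rdot z v] lie in [0, 2], so moving [F z] by a fraction
   [t] towards the interior point [p] increases them by the factor [1 + t (1
   - |p|) / 2] more than it scales differences. *)
Lemma linked_damped F t p c z w : contractive F -> 0 <= t <= 1 -> l2norm p < 1 ->
  0 <= c -> l2norm z < 1 -> l2norm w < 1 -> linked c z w ->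
  linked ((1 + t * (1 - l2norm p) / 2) * c) (damped F t p z) (damped F t p w).
Proof.
move=> [FB FL] /andP[t0 t1] p1 c0 z1 w1 h v v1.
have hv := FL _ _ _ c0 z1 w1 h v v1.
set k := t * (1 - l2norm p) / 2.
have k0 : 0 <= k by rewrite /k divr_ge0 // mulr_ge0 //; lra.
have -> : damped F t p w - damped F t p z = (1 - t)%:C *: (F w - F z).
  by rewrite /damped scalerBr opprD addrACA subrr addr0.
rewrite hdotZl sqmodM sqmod_real.
have side x : l2norm x < 1 ->
    (1 - t) * (1 + k) * (1 - rdot (F x) v) <= 1 - rdot (damped F t p x) v.
  move=> x1; rewrite /damped rdotDl !rdotZl.
  have := rdot_ge_norm (F x) v1; have := FB x x1; have := rdot_le_norm p v1.
  have := rdot_le_norm (F x) v1.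
  move=> hx hp hF hF'.
  have hk : (1 - t) * k * (1 - rdot (F x) v) <= t * (1 - l2norm p).
    have -> : t * (1 - l2norm p) = k * 2 by rewrite /k; field.
    rewrite mulrAC mulrC ler_wpM2l //.
    by apply: (@le_trans _ _ (1 * 2)); [apply: ler_pM; lra | lra].
  by nra.
have pos x : l2norm x < 1 -> 0 <= (1 - t) * (1 + k) * (1 - rdot (F x) v).
  move=> x1; have := rdot_le_norm (F x) v1; have := FB x x1 => h1 h2.
  by rewrite !mulr_ge0 //; lra.
have := ler_pM (pos _ z1) (pos _ w1) (side _ z1) (side _ w1).
move=> hAB.
have h5 : (1 + k) ^+ 2 * (1 - t) ^+ 2 * (c ^+ 2 * sqmod (hdot (F w - F z) v)) <=
    (1 + k) ^+ 2 * (1 - t) ^+ 2 * (4 * (1 - rdot (F z) v) * (1 - rdot (F w) v)).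
  by rewrite ler_wpM2l // mulr_ge0 ?sqr_ge0.
by lra.
Qed.

End LinkedPoints.

(** * Fixed points of damped maps and displacement of the original map *)

Section Damped.
Context {R : realType} {d : nat}.
Local Notation C := R[i].
Implicit Types (x y z w v p : 'rV[C]_d) (c e t rho : R) (F : 'rV[C]_d -> 'rV[C]_d).

Lemma damped_iter_ball F t p j : contractive F -> 0 <= t <= 1 -> l2norm p < 1 ->
  l2norm (iter j (damped F t p) p) < 1.
Proof. by move=> FC t01 p1; elim: j => //= j IH; apply: damped_ball1. Qed.

Lemma bernoulli (k : R) j : 0 <= k -> 1 + j%:R * k <= (1 + k) ^+ j.
Proof.
move=> k0; elim: j => [|j IH]; first by rewrite mul0r addr0 expr0.
rewrite exprS -natr1; have j0 : 0 <= j%:R :> R by [].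
have jk : 0 <= j%:R * k by rewrite mulr_ge0.
by nra.
Qed.

Lemma exists_nat_gt (a : R) : exists N : nat, a < N%:R.
Proof. by exists (Num.trunc `|a|).+1; apply: le_lt_trans (ler_norm a) (truncnS_gt _). Qed.

(** Each damped step multiplies the link constant of consecutive orbit points by [1 + k]; by
    Bernoulli it grows without bound, so [linked_dist] makes the steps small. *)
Lemma damped_asymptotic F t p e : contractive F -> 0 < t <= 1 -> l2norm p < 1 ->
  0 < e -> exists N, forall j, (N <= j)%N ->
    l2norm (iter j.+1 (damped F t p) p - iter j (damped F t p) p) <= e.
Proof.
move=> FC t01 p1 e0; have /andP[t0 t1] := t01.
have t01' : 0 <= t <= 1 by rewrite ltW.
set s := fun j => iter j (damped F t p) p.
have sB j : l2norm (s j) < 1 := damped_iter_ball j FC t01' p1.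
set k := t * (1 - l2norm p) / 2.
have k0 : 0 < k by rewrite /k divr_gt0 // mulr_gt0 // subr_gt0.
(* The constant [1 - rho] links the first two points because their distance is at most 2. *)
pose rho := Num.max (l2norm (s 0%N)) (l2norm (s 1%N)).
have rho1 : rho < 1 by rewrite /rho gt_max !sB.
have c0 : 0 < 1 - rho by lra.
have link0 : linked (1 - rho) (s 0%N) (s 1%N).
  apply: (linked_of_dist (rho := rho)); rewrite ?(ltW c0) ?(ltW rho1) //.
  - by rewrite /rho le_max lexx.
  - by rewrite /rho le_max lexx orbT.
  rewrite mulrC ler_wpM2r ?(ltW c0) //.
  have := l2normD (s 1%N) (- s 0%N); rewrite l2normN => h.
  by have := sB 0%N; have := sB 1%N; lra.
have link j : linked ((1 + k) ^+ j * (1 - rho)) (s j) (s j.+1).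
  elim: j => [|j IH]; first by rewrite expr0 mul1r.
  rewrite exprS -mulrA; apply: linked_damped => //; last exact: (sB j.+1).
  by rewrite mulr_ge0 ?exprn_ge0 ?(ltW c0) // addr_ge0 ?(ltW k0).
have [N hN] := exists_nat_gt (4 / (e * (1 - rho) * k)).
exists N => j Nj.
have pj : 0 < (1 + k) ^+ j by rewrite exprn_gt0 // addr_gt0.
have := linked_dist (ltW (mulr_gt0 pj c0)) (sB j) (sB j.+1) (link j).
rewrite -ler_pdivlMl ?mulr_gt0 // => h; apply: le_trans h _.
rewrite ler_pdivrMl ?mulr_gt0 //.
have hb := bernoulli j (ltW k0).
have hN2 : 4 < N%:R * (e * (1 - rho) * k) by rewrite -ltr_pdivrMr // mulr_gt0 // mulr_gt0.
have Nj' : N%:R <= j%:R :> R by rewrite ler_nat.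
have h1 : 4 <= j%:R * k * (e * (1 - rho)).
  apply: le_trans (ltW hN2) _.
  have -> : j%:R * k * (e * (1 - rho)) = j%:R * (e * (1 - rho) * k) by ring.
  by rewrite ler_wpM2r // mulr_ge0 ?(ltW k0) // mulr_ge0 ?(ltW e0) ?(ltW c0).
apply: le_trans h1 _.
have -> : (1 + k) ^+ j * (1 - rho) * e = (1 + k) ^+ j * (e * (1 - rho)) by ring.
rewrite ler_wpM2r ?mulr_ge0 ?(ltW e0) ?(ltW c0) //.
by apply: le_trans hb; rewrite lerDr.
Qed.

Lemma l2norm_eq0_eps x K : (forall e, 0 < e -> l2norm x <= K * e) -> x = 0.
Proof.
move=> h; apply: l2norm_eq0; apply/le_anti; rewrite l2norm_ge0 andbT.
rewrite leNgt; apply/negP => x0.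
have K1 : 0 < `|K| + 1 by rewrite ltr_wpDl.
have := h (l2norm x / (`|K| + 1)) (divr_gt0 x0 K1); rewrite mulrA ler_pdivlMr // => h2.
by have := ler_norm K; nra.
Qed.

Lemma l2norm_le_eps x y e : l2norm (x - y) < e -> l2norm y <= l2norm x + e.
Proof. by move=> h; have := l2normB_le y x; rewrite l2distC; lra. Qed.

Lemma l2norm_cluster_le (s : nat -> 'rV[C]_d) y rho :
  (forall e, 0 < e -> forall N, exists2 k, (N <= k)%N & l2norm (s k - y) < e) ->
  (forall k, l2norm (s k) <= rho) -> l2norm y <= rho.
Proof.
move=> cl sr; apply/ler_addgt0Pr => e e0.
have [k _ /l2norm_le_eps h] := cl e e0 0%N.
by apply: le_trans h _; rewrite lerD2r.
Qed.

Lemma l2_bolzano_weierstrass (s : nat -> 'rV[C]_d) rho :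
  (forall k, l2norm (s k) <= rho) ->
  exists y, l2norm y <= rho /\
    forall e, 0 < e -> forall N, exists2 k, (N <= k)%N & l2norm (s k - y) < e.
Proof.
move=> sr; have [k|y cl] := @bolzano_weierstrass R d s (rho ^+ 2).
  by rewrite -l2norm_le // (le_trans (l2norm_ge0 _) (sr k)).
by exists y; split => //; apply: l2norm_cluster_le sr.
Qed.

(** The orbit of [p] stays in a ball of radius less than 1, so it has an interior cluster point;
    small steps and the Lipschitz bound there make it a fixed point. *)
Lemma damped_fixpoint F t p : contractive F -> 0 < t <= 1 -> l2norm p < 1 ->
  exists x, [/\ l2norm x < 1, damped F t p x = x &
    forall e, 0 < e -> exists j, l2norm (iter j (damped F t p) p - x) < e].
Proof.
move=> FC t01 p1; have /andP[t0 t1] := t01.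
have t01' : 0 <= t <= 1 by rewrite ltW.
set s := fun j => iter j (damped F t p) p.
have sB j : l2norm (s j) < 1 := damped_iter_ball j FC t01' p1.
pose rho := (1 - t) + t * l2norm p.
have rho1 : rho < 1 by rewrite /rho; nra.
have sr j : l2norm (s j) <= rho.
  case: j => [|j]; last exact: damped_ball.
  by rewrite /rho /s /=; nra.
have [x [xr cl]] := l2_bolzano_weierstrass sr.
exists x; split; first exact: le_lt_trans rho1.
  (* The path from the image of [x] through [s j.+1] and [s j] to [x] costs [2 / (1 - rho) * e],
     then [e], then [e]. *)
  apply: subr0_eq; apply: (@l2norm_eq0_eps _ (2 / (1 - rho) + 2)) => e e0.
  have [N hN] := damped_asymptotic FC t01 p1 e0.
  have [j Nj je] := cl e e0 N.
  have := hN j Nj; rewrite -/(s j) -/(s j.+1) => h1.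
  have h2 : l2norm (damped F t p x - s j.+1) <= 2 / (1 - rho) * e.
    have -> : damped F t p x - s j.+1 = (1 - t)%:C *: (F x - F (s j)).
      by rewrite /= /damped -/(s j) scalerBr opprD addrACA subrr addr0.
    rewrite l2normZ ?subr_ge0 //.
    have h := contractive_lipschitz FC rho1 (sr j) xr.
    have h' : l2norm (F x - F (s j)) <= 2 / (1 - rho) * e.
      apply: le_trans h _; rewrite ler_wpM2l // ?divr_ge0 ?subr_ge0 ?(ltW rho1) //.
      by rewrite l2distC ltW.
    apply: le_trans h'; rewrite ler_piMl ?l2norm_ge0 //.
    by lra.
  apply: le_trans (l2dist_triangle (damped F t p x) (s j.+1) x) _.
  have -> : (2 / (1 - rho) + 2) * e = 2 / (1 - rho) * e + (e + e) by ring.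
  apply: lerD h2 (le_trans (l2dist_triangle (s j.+1) (s j) x) _).
  exact: lerD h1 (ltW je).
by move=> e e0; have [j _ je] := cl e e0 0%N; exists j.
Qed.

(** Otherwise points of the ball moved by less than [1 / (k + 1)] would cluster at a fixed point. *)
Lemma displacement_bound F rho : contractive F ->
  (forall z, l2norm z < 1 -> F z <> z) -> rho < 1 ->
  exists2 mu, 0 < mu & forall z, l2norm z <= rho -> mu <= l2norm (F z - z).
Proof.
move=> FC nofix rho1; apply: contrapT => no.
have h (k : nat) : exists z, l2norm z <= rho /\ l2norm (F z - z) < k.+1%:R^-1.
  apply: contrapT => no2; apply: no; exists k.+1%:R^-1; first by rewrite invr_gt0.
  move=> z zr; rewrite leNgt; apply/negP => h; apply: no2; by exists z.
have [s hs] := choice h.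
have [x [xr cl]] := l2_bolzano_weierstrass (fun k => (hs k).1).
apply: (nofix x); first exact: le_lt_trans rho1.
apply: subr0_eq; apply: (@l2norm_eq0_eps _ (2 / (1 - rho) + 2)) => e e0.
have [N hN] := exists_nat_gt e^-1.
have [k Nk ke] := cl e e0 N.
have h1 : l2norm (F (s k) - s k) <= e.
  apply: le_trans (ltW (hs k).2) _; rewrite -[e]invrK lef_pV2 ?posrE ?invr_gt0 //.
  by apply: le_trans (ltW hN) _; rewrite ler_nat; apply: leq_trans Nk _.
have h2 : l2norm (F x - F (s k)) <= 2 / (1 - rho) * e.
  apply: le_trans (contractive_lipschitz FC rho1 (hs k).1 xr) _.
  rewrite ler_wpM2l // ?divr_ge0 ?subr_ge0 ?(ltW rho1) //.
  by rewrite l2distC ltW.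
have h3 := l2dist_triangle (F x) (F (s k)) x.
have h4 := l2dist_triangle (F (s k)) (s k) x.
by lra.
Qed.

End Damped.

(** * Orbits of a map without fixed points leave every smaller ball for good *)

Section Escape.
Context {R : realType} {d : nat}.
Local Notation C := R[i].
Implicit Types (x y z w v p u : 'rV[C]_d) (c e t rho : R) (F : 'rV[C]_d -> 'rV[C]_d).

Lemma sqmod_convex (a b : C) t : 0 <= t <= 1 ->
  sqmod ((1 - t)%:C * a + t%:C * b) <= (1 - t) * sqmod a + t * sqmod b.
Proof.
move=> /andP[t0 t1]; rewrite /sqmod complex_ReD complex_ImD !complex_ReZ !complex_ImZ.
have conv (r s : R) : ((1 - t) * r + t * s) ^+ 2 <= (1 - t) * r ^+ 2 + t * s ^+ 2.
  have : 0 <= t * (1 - t) * (r - s) ^+ 2 by rewrite mulr_ge0 ?sqr_ge0 // mulr_ge0 // subr_ge0.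
  by lra.
have := conv (complex.Re a) (complex.Re b); have := conv (complex.Im a) (complex.Im b).
by lra.
Qed.

(** For fixed [u] and [v] the left side of the link is convex in the second point and the right side
    is affine. *)
Lemma linked_convex c t u z w : 0 <= t <= 1 -> l2norm u < 1 ->
  linked c u z -> linked c u w -> linked c u ((1 - t)%:C *: z + t%:C *: w).
Proof.
move=> t01 u1 hz hw v v1; have /andP[t0 t1] := t01.
have -> : (1 - t)%:C *: z + t%:C *: w - u = (1 - t)%:C *: (z - u) + t%:C *: (w - u).
  rewrite !scalerBr addrACA -opprD -scalerDl -rmorphD /= subrK.
  by rewrite (rmorph1 (real_complex R)) scale1r.
rewrite hdotDl !hdotZl rdotDl !rdotZl.
have := sqmod_convex (hdot (z - u) v) (hdot (w - u) v) t01.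
have := hz v v1; have := hw v v1.
move: (sqmod (hdot (z - u) v)) (sqmod (hdot (w - u) v)) (sqmod (_ * _ + _)) => A B S.
move: (rdot u v) (rdot z v) (rdot w v) => a b e hB hA hS.
have hS' : c ^+ 2 * S <= c ^+ 2 * ((1 - t) * A + t * B) by rewrite ler_wpM2l ?sqr_ge0.
have hA' : (1 - t) * (c ^+ 2 * A) <= (1 - t) * (4 * (1 - a) * (1 - b)).
  by rewrite ler_wpM2l // subr_ge0.
have hB' : t * (c ^+ 2 * B) <= t * (4 * (1 - a) * (1 - e)) by rewrite ler_wpM2l.
by lra.
Qed.

Lemma linked_le c c' z w : 0 <= c' <= c -> linked c z w -> linked c' z w.
Proof.
move=> /andP[c0 cc] h v v1; apply: le_trans (h v v1).
by rewrite ler_wpM2r ?sqmod_ge0 // ler_sqr ?nnegrE // (le_trans c0).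
Qed.

Lemma l2normB_le2 x y : l2norm x < 1 -> l2norm y < 1 -> l2norm (x - y) <= 2.
Proof.
by move=> x1 y1; have := l2normD x (- y); rewrite l2normN; lra.
Qed.

Lemma damped_displacement F t p z : 0 <= t -> l2norm (F z) < 1 -> l2norm p < 1 ->
  l2norm (F z - z) <= l2norm (damped F t p z - z) + t * 2.
Proof.
move=> t0 Fz1 p1.
have -> : F z - z = (damped F t p z - z) + t%:C *: (F z - p).
  apply/rowP => j; rewrite !mxE rmorphB (rmorph1 (real_complex R)); ring.
apply: le_trans (l2normD _ _) _; rewrite lerD2l l2normZ // ler_wpM2l //.
exact: l2normB_le2.
Qed.

(** If no fixed point exists, [F] has displacement at least some [mu > 0] on the invariant convex
    set [A]. Damping towards [y], itself in [A], keeps [A] invariant and yields a point of [A] moved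
    by less than [mu]. *)
Lemma fixpoint_of_bounded_orbit F y rho : contractive F -> rho < 1 ->
  (forall k, l2norm (iter k F y) <= rho) -> exists2 z, l2norm z < 1 & F z = z.
Proof.
move=> FC rho1 yr; apply: contrapT => nofix'.
have nofix z : l2norm z < 1 -> F z <> z by move=> z1 Fz; apply: nofix'; exists z.
pose c := 1 - rho; have c0 : 0 < c by rewrite subr_gt0.
(* Only a tail of the orbit is required: applying [F] shifts the starting index [m] to [m.+1]. *)
pose A z := l2norm z < 1 /\ exists m, forall k, (m <= k)%N -> linked c (iter k F y) z.
have [rho' rho'1 bnd] := @linked_bound R d _ _ c0 rho1.
have Ar z : A z -> l2norm z <= rho'.
  by move=> [z1 [m /(_ m (leqnn m)) h]]; exact: bnd (yr m) z1 h.
have yA : A y.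
  split; first exact: le_lt_trans (yr 0%N) rho1.
  exists 0%N => k _; apply: (linked_of_dist (ltW c0) (ltW rho1) (yr k) (yr 0%N)).
  rewrite /c mulrC ler_wpM2r ?(ltW c0) // l2normB_le2 //.
    exact: le_lt_trans (yr 0%N) rho1.
  exact: le_lt_trans (yr k) rho1.
have AF z : A z -> A (F z).
  move=> [z1 [m h]]; split; first exact: FC.1.
  exists m.+1 => -[//|k] mk; apply: (FC.2 _ _ _ (ltW c0) _ z1 (h k mk)).
  exact: le_lt_trans (yr k) rho1.
have Ad t z : 0 <= t <= 1 -> A z -> A (damped F t y z).
  move=> t01 zA; split; first exact: damped_ball1 FC t01 yA.1 zA.1.
  have [_ [m1 h1]] := AF z zA; have [_ [m2 h2]] := yA.
  exists (maxn m1 m2) => k; rewrite geq_max => /andP[k1 k2].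
  apply: linked_convex => //; [exact: le_lt_trans (yr k) rho1 | exact: h1 | exact: h2].
have [mu mu0 hmu] := displacement_bound FC nofix rho'1.
(* The displacement found below is at most [mu / 4 + 2 t], hence at most [mu / 2]. *)
pose t := Num.min 1 (mu / 8).
have t01 : 0 < t <= 1 by rewrite /t lt_min ltr01 divr_gt0 //= ge_min lexx.
have t01' : 0 <= t <= 1 by case/andP: t01 => /ltW -> ->.
have tmu : t <= mu / 8 by rewrite /t ge_min lexx orbT.
have [N hN] := damped_asymptotic FC t01 yA.1 (divr_gt0 mu0 (ltr0n _ 4)).
have sA : A (iter N (damped F t y) y) by elim: N {hN} => //= N IH; apply: Ad.
have := hN N (leqnn N); rewrite iterS.
move: (iter N _ y) sA => z zA hz.
have := damped_displacement (proj1 (andP t01')) (FC.1 z zA.1) yA.1.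
by have := hmu z (Ar z zA); lra.
Qed.

(** The constant does not depend on [k], since all iterates are contractive. *)
Lemma iter_near F rho e z w k : contractive F -> rho < 1 ->
  l2norm z <= rho -> l2norm w <= rho -> l2norm (w - z) <= e ->
  l2norm (iter k F w - iter k F z) <= 2 / (1 - rho) * e.
Proof.
move=> FC rho1 zr wr h.
apply: le_trans (contractive_lipschitz (contractive_iter k FC) rho1 zr wr) _.
by rewrite ler_wpM2l // divr_ge0 // subr_ge0 ltW.
Qed.

Definition recurrent F y : Prop := forall e, 0 < e -> forall N,
  exists2 q, (N <= q)%N & l2norm (iter q F y - y) < e.

(** Let [y] be a cluster point of the returns to the ball. If the returns at times [g a] and [g b]
    are both near [y], then the iterate of order [g b - g a] sends [y] close to itself. *)
Lemma exists_recurrent F z rho : contractive F -> rho < 1 ->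
  (forall N, exists2 k, (N <= k)%N & l2norm (iter k F z) <= rho) ->
  exists2 y, l2norm y <= rho & recurrent F y.
Proof.
move=> FC rho1 often.
have /choice[g hg] : forall N, exists k, (N <= k)%N /\ l2norm (iter k F z) <= rho.
  by move=> N; have [k] := often N; exists k.
have gN N := (hg N).1; have gr N := (hg N).2.
have [y [yr cl]] := l2_bolzano_weierstrass gr.
exists y => // e e0 N; set L := 2 / (1 - rho).
have L0 : 0 <= L by rewrite divr_ge0 // subr_ge0 ltW.
have e'0 : 0 < e / (L + 2) by rewrite divr_gt0 // ltr_wpDl.
(* As [g b >= b], taking [b] beyond [g a + N] makes the time difference at least [N]. *)
have [a _ ha] := cl _ e'0 0%N; have [b hb hb'] := cl _ e'0 (g a + N)%N.
have ab : (g a + N <= g b)%N := leq_trans hb (gN b).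
have ab' : (g a <= g b)%N := leq_trans (leq_addr _ _) ab.
exists (g b - g a)%N; first by rewrite leq_subRL.
have hI : iter (g b) F z = iter (g b - g a) F (iter (g a) F z) by rewrite -iterD subnK.
rewrite hI in hb'; rewrite l2distC in ha.
have := iter_near (g b - g a) FC rho1 (gr a) yr (ltW ha); rewrite -/L => h.
apply: le_lt_trans (l2dist_triangle _ (iter (g b - g a) F (iter (g a) F z)) _) _.
apply: lt_trans (_ : (L + 1) * (e / (L + 2)) < _); first by rewrite mulrDl mul1r ler_ltD.
by rewrite mulrA ltr_pdivrMr ?ltr_wpDl // mulrC ltr_pM2l // ltrD2l ltr1n.
Qed.

(** Otherwise there are visits followed by ever longer absences. Two such visits close to each other
    lead to a contradiction: the first comes back near [y] by recurrence, and [iter_near] forces the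
    second to come back at the same delay, inside its absence. *)
Lemma recurrent_gaps F y rho : contractive F -> rho < 1 -> l2norm y < rho ->
  recurrent F y -> exists P, forall n, l2norm (iter n F y) <= rho ->
    exists2 p : nat, (0 < p <= P)%N & l2norm (iter (n + p) F y) <= rho.
Proof.
move=> FC rho1 yrho rec; apply: contrapT => no.
have hP P : exists n, l2norm (iter n F y) <= rho /\
    forall p : nat, (0 < p <= P)%N -> rho < l2norm (iter (n + p) F y).
  apply: contrapT => no2; apply: no; exists P => n nr.
  apply: contrapT => no3; apply: no2; exists n; split=> // p pP.
  by rewrite ltNge; apply/negP => h; apply: no3; exists p.
have [g hg] := choice hP.
have [u [ur cl]] := l2_bolzano_weierstrass (fun P => (hg P).1).
set L := 2 / (1 - rho).
have L0 : 0 <= L by rewrite divr_ge0 // subr_ge0 ltW.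
(* The errors add up to [(2 L + 1) e], less than the room [rho - |y|]. *)
pose e := (rho - l2norm y) / (2 * L + 2).
have d0 : 0 < 2 * L + 2 by rewrite ltr_wpDl // mulr_ge0.
have e0 : 0 < e by rewrite divr_gt0 // subr_gt0.
have [a _ ha] := cl e e0 0%N.
have [q hq hq'] := rec e e0 (g a).+1.
have [b hb hb'] := cl e e0 (q - g a)%N.
have p0 : (0 < q - g a)%N by rewrite subn_gt0.
have := (hg b).2 (q - g a)%N; rewrite p0 hb => /(_ isT).
rewrite addnC iterD ltNge => /negP; apply.
have hab : l2norm (iter (g b) F y - iter (g a) F y) <= 2 * e.
  apply: le_trans (l2dist_triangle _ u _) _; rewrite [X in _ + X]l2distC.
  by rewrite mulr_natl mulr2n; apply: ltW; apply: ltrD.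
have := iter_near (q - g a) FC rho1 (hg a).1 (hg b).1 hab; rewrite -/L.
rewrite -[iter _ _ (iter (g a) _ _)]iterD subnK; last exact: ltnW.
move: hq'; move: (iter q F y) (iter (q - g a) F _) => s w hs hw.
have := l2normB_le w s; have := l2normB_le s y.
have : (2 * L + 2) * e = rho - l2norm y by rewrite /e mulrC divfK // gt_eqF.
by lra.
Qed.

Lemma exists_ball_bound (g : nat -> 'rV[C]_d) P : (forall i, l2norm (g i) < 1) ->
  exists2 rho, rho < 1 & forall i, (i <= P)%N -> l2norm (g i) <= rho.
Proof.
move=> g1; elim: P => [|P [rho rho1 IH]].
  by exists (l2norm (g 0%N)) => // i; rewrite leqn0 => /eqP->.
exists (Num.max rho (l2norm (g P.+1))) => [|i]; first by rewrite gt_max rho1 g1.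
rewrite leq_eqVlt => /predU1P[->|iP]; first by rewrite le_max lexx orbT.
by rewrite le_max IH.
Qed.

(* Calka's argument: the return times of a recurrent point to a fixed ball
   have bounded gaps, so its whole orbit stays at bounded distance from
   finitely many of its points. *)
Lemma recurrent_orbit_bounded F y rho : contractive F -> rho < 1 ->
  l2norm y < rho -> recurrent F y ->
  exists2 rho', rho' < 1 & forall n, l2norm (iter n F y) <= rho'.
Proof.
move=> FC rho1 yrho rec; have [P hP] := recurrent_gaps FC rho1 yrho rec.
have y1 := lt_trans yrho rho1.
have yB k : l2norm (iter k F y) < 1 by exact: (contractive_iter k FC).1.
have near n : exists m, [/\ (m <= n)%N, (n <= m + P)%N & l2norm (iter m F y) <= rho].
  elim: n => [|n [m [mn nm hm]]]; first by exists 0%N; split => //; exact: ltW.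
  have [nmP|] := ltnP n (m + P); first by exists m; split => //; exact: leqW.
  move=> mPn; have [p /andP[p0 pP] hp] := hP m hm.
  exists (m + p)%N; split => //.
    by apply: leqW; apply: leq_trans mPn; rewrite leq_add2l.
  rewrite -addnA; apply: leq_ltn_trans nm _.
  by rewrite ltn_add2l -[X in (X < _)%N]add0n ltn_add2r.
have [r1 r11 hr1] := exists_ball_bound P yB.
have c0 : 0 < 1 - rho by rewrite subr_gt0.
have [rho' rho'1 bnd] := @linked_bound R d _ _ c0 r11.
exists rho' => // n; have [m [mn nm hm]] := near n.
have := subnK mn; set i := (n - m)%N => <-; rewrite iterD.
have iP : (i <= P)%N by rewrite /i leq_subLR.
(* Both [y] and its iterate of order [m] lie in the ball of radius [rho], hence are linked; [i]
   further steps keep the link and bring the first to one of finitely many points. *)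
apply: (bnd _ _ (hr1 i iP)); first by rewrite -iterD.
apply: ((contractive_iter i FC).2 _ _ _ (ltW c0)) => //.
apply: (linked_of_dist (rho := rho)) => //; try exact: ltW.
by rewrite mulrC ler_wpM2r ?(ltW c0) // l2normB_le2.
Qed.

Lemma orbit_escapes F z rho : contractive F ->
  (forall x, l2norm x < 1 -> F x <> x) -> rho < 1 ->
  exists N, forall k, (N <= k)%N -> rho < l2norm (iter k F z).
Proof.
move=> FC nofix rho1; apply: contrapT => no.
have [N|y yr rec] := @exists_recurrent F z rho FC rho1.
  apply: contrapT => no2; apply: no; exists N => k Nk.
  by rewrite ltNge; apply/negP => h; apply: no2; exists k.
(* The radius is enlarged to the midpoint because the gap argument needs [y] strictly inside the
   ball. *)
have yr2 : l2norm y < (1 + rho) / 2 by lra.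
have r2 : (1 + rho) / 2 < 1 by lra.
have [rho' rho'1 hb] := recurrent_orbit_bounded FC r2 yr2 rec.
have [x x1 Fx] := fixpoint_of_bounded_orbit FC rho'1 hb.
exact: nofix Fx.
Qed.

End Escape.

(** * The boundary point and the convergence of the orbit of 0 *)

Section Boundary.
Context {R : realType} {d : nat}.
Local Notation C := R[i].
Implicit Types (x y z w v u zeta : 'rV[C]_d) (c e t s rho : R) (F : 'rV[C]_d -> 'rV[C]_d).

Lemma damped0E F t z : damped F t 0 z = (1 - t)%:C *: F z.
Proof. by rewrite /damped scaler0 addr0. Qed.

(** Induction on [j]; the local Lipschitz bound propagates the error, and damping adds at most [t]
    at each step. *)
Lemma damped_iter_cvg F z j : contractive F -> l2norm z < 1 ->
  forall e, 0 < e -> exists2 delta, 0 < delta & forall t, 0 <= t <= 1 -> t <= delta ->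
    l2norm (iter j (damped F t 0) z - iter j F z) <= e.
Proof.
move=> FC z1; elim: j => [|j IH] e e0.
  by exists 1 => // t _ _; rewrite subrr l2norm0 ltW.
have u1 : l2norm (iter j F z) < 1 by exact: (contractive_iter j FC).1.
move: IH; rewrite iterS; set u := iter j F z => IH.
pose rho := (1 + l2norm u) / 2; have rho1 : rho < 1 by rewrite /rho; lra.
set L := 2 / (1 - rho); have L0 : 0 <= L by rewrite divr_ge0 // subr_ge0 ltW.
(* The first entry keeps the damped iterate in the ball of radius [rho]; the second makes the
   propagated error at most [e / 2]. *)
pose e' := Num.min ((1 - l2norm u) / 2) (e / (2 * (L + 1))).
have e'0 : 0 < e'.
  by rewrite /e' lt_min !divr_gt0 ?subr_gt0 // mulr_gt0 // ltr_wpDl.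
have [dl dl0 hdl] := IH e' e'0.
exists (Num.min dl (e / 2)); first by rewrite lt_min dl0 divr_gt0.
move=> t t01; rewrite le_min => /andP[tdl te].
have := hdl t t01 tdl; rewrite iterS; move: (iter j (damped F t 0) z) => w.
rewrite /e' le_min => /andP[h1 h2].
have wr : l2norm w <= rho by have := l2normB_le w u; rewrite /rho; lra.
have ur : l2norm u <= rho by rewrite /rho; lra.
have w1 := le_lt_trans wr rho1.
have -> : damped F t 0 w - F u = (F w - F u) - t%:C *: F w.
  by rewrite damped0E rmorphB (rmorph1 (real_complex R)) scalerBl scale1r addrAC.
apply: le_trans (l2normD _ _) _; rewrite l2normN.
have /andP[t0 t1] := t01; rewrite l2normZ //.
have h3 := contractive_lipschitz FC rho1 ur wr; rewrite -/L in h3.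
have h4 : L * l2norm (w - u) <= e / 2.
  apply: le_trans (_ : L * (e / (2 * (L + 1))) <= _); first by rewrite ler_wpM2l.
  have -> : L * (e / (2 * (L + 1))) = (e / 2) * (L / (L + 1)).
    by field; rewrite gt_eqF // ltr_wpDl.
  rewrite ler_piMr ?divr_ge0 ?(ltW e0) // ler_pdivrMr ?mul1r ?lerDl //.
  by rewrite ltr_wpDl.
have h5 : t * l2norm (F w) <= e / 2.
  by apply: le_trans te; rewrite ler_piMr // ltW // FC.1.
by lra.
Qed.

(** Since the damped map fixes [x], the link with [x] persists along the orbit; the gain in the
    constant is discarded. *)
Lemma linked_damped_iter F t c x w j : contractive F -> 0 <= t <= 1 -> 0 <= c ->
  l2norm x < 1 -> l2norm w < 1 -> damped F t 0 x = x -> linked c x w ->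
  linked c x (iter j (damped F t 0) w) /\ l2norm (iter j (damped F t 0) w) < 1.
Proof.
move=> FC t01 c0 x1 w1 fx h; elim: j => [//|j [IH IH1]]; rewrite iterS.
have o1 : l2norm (0 : 'rV[C]_d) < 1 by rewrite l2norm0.
split; last exact: damped_ball1.
rewrite -{1}fx; apply: linked_le (linked_damped FC t01 o1 c0 x1 IH1 IH).
rewrite c0 l2norm0 subr0 mulr1 ler_peMl // lerDl divr_ge0 //.
by case/andP: t01.
Qed.

(** Replaces the direction [v = x / |x|] by [zeta]: [1 - |x|] costs one distance [|x - zeta|], and
    [|v - zeta|] costs two. *)
Lemma one_sub_rdot_le zeta x W : l2norm zeta = 1 -> 0 < l2norm x -> l2norm x < 1 ->
  l2norm W < 1 ->
  forall W' , 1 - rdot W' zeta <=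
    (l2norm x - rdot W ((l2norm x)^-1%:C *: x)) + 3 * l2norm (x - zeta) + l2norm (W - W').
Proof.
move=> z1 x0 x1 W1 W'; set v := _ *: x.
have vn : normsq v <= 1.
  by rewrite /v normsqZ sqmod_real -sqr_l2norm -exprMn mulVf ?gt_eqF // expr1n.
have h1 : 1 - l2norm x <= l2norm (x - zeta).
  by rewrite l2distC; have := l2normB_le zeta x; rewrite z1; lra.
have h2 : l2norm (v - x) = 1 - l2norm x.
  have -> : v - x = ((l2norm x)^-1 - 1)%:C *: x.
    by rewrite rmorphB (rmorph1 (real_complex R)) scalerBl scale1r.
  rewrite l2normZ ?subr_ge0 ?invf_ge1 ?ltW //.
  by rewrite mulrBl mul1r mulVf ?gt_eqF.
have h3 : rdot W (v - zeta) <= l2norm (v - zeta).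
  apply: le_trans (rdot_le _ _) _; rewrite ler_piMl ?l2norm_ge0 //.
  exact: ltW.
have h4 := l2dist_triangle v x zeta.
have h5 : rdot (W - W') zeta <= l2norm (W - W').
  by apply: le_trans (rdot_le _ _) _; rewrite z1 mulr1.
by move: h3 h5; rewrite rdotBr rdotBl; lra.
Qed.

(* [x] is a fixed point of a damping of [F] close to [zeta]; linking it to
   [s zeta] with constant [c] such that [c ^+ 2 = (1 - |x|) / (1 - s)] and
   testing against [x / |x|], the factor [1 - |x|] cancels. *)
Lemma fixpoint_horoball F t x zeta s j : contractive F -> 0 <= t <= 1 ->
  0 < l2norm x -> l2norm x < 1 -> damped F t 0 x = x -> l2norm zeta = 1 ->
  0 < s < 1 -> l2norm (x - zeta) <= 1 - s ->
  (l2norm x - rdot (iter j (damped F t 0) (s%:C *: zeta)) ((l2norm x)^-1%:C *: x)) ^+ 2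
    <= 8 * (1 - s).
Proof.
move=> FC t01 x0 x1 fx z1 /andP[s0 s1] xz.
set w := s%:C *: zeta; set v := _ *: x.
have wn : l2norm w = s by rewrite /w l2normZ ?(ltW s0) // z1 mulr1.
have zn : normsq zeta = 1 by rewrite -sqr_l2norm z1 expr1n.
have vn : normsq v <= 1.
  by rewrite /v normsqZ sqmod_real -sqr_l2norm -exprMn mulVf ?gt_eqF // expr1n.
have xv : rdot x v = l2norm x.
  by rewrite /v rdotZr -/(normsq x) -sqr_l2norm expr2 mulKf ?gt_eqF.
have e0 : 0 < 1 - l2norm x by rewrite subr_gt0.
have s10 : 0 < 1 - s by rewrite subr_gt0.
pose c := Num.sqrt ((1 - l2norm x) / (1 - s)).
have cE : c ^+ 2 = (1 - l2norm x) / (1 - s) by rewrite sqr_sqrtr // divr_ge0 // ltW.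
have link : linked c x w.
  move=> a a1; rewrite cE.
  have h1 := rdot_le_norm x a1.
  have h2 : rdot w a <= s by rewrite -wn; exact: rdot_le_norm.
  have h3 : sqmod (hdot (w - x) a) <= (2 * (1 - s)) ^+ 2.
    apply: le_trans (sqmod_hdot_le_normsq _ a1) _.
    rewrite -l2norm_le ?mulr_ge0 // ?(ltW s10) //.
    apply: le_trans (l2dist_triangle w zeta x) _; rewrite [l2norm (zeta - x)]l2distC.
    have -> : l2norm (w - zeta) = 1 - s.
      have -> : w - zeta = - ((1 - s)%:C *: zeta).
        by rewrite rmorphB (rmorph1 (real_complex R)) scalerBl scale1r opprB.
      by rewrite l2normN l2normZ ?(ltW s10) // z1 mulr1.
    by lra.
  apply: le_trans (_ : (1 - l2norm x) / (1 - s) * (2 * (1 - s)) ^+ 2 <= _).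
    by rewrite ler_wpM2l // divr_ge0 // ltW.
  have -> : (1 - l2norm x) / (1 - s) * (2 * (1 - s)) ^+ 2 = 4 * ((1 - l2norm x) * (1 - s)).
    by field; rewrite gt_eqF.
  by rewrite -mulrA ler_wpM2l // ler_pM ?(ltW e0) ?(ltW s10) // lerD2l lerN2.
have w1 : l2norm w < 1 by rewrite wn.
have [h W1] := linked_damped_iter j FC t01 (sqrtr_ge0 _) x1 w1 fx link.
move: (iter j _ w) h W1 => W h W1.
have := h v vn; rewrite xv cE => h1.
have := sqr_rdot_le (W - x) v; rewrite rdotBl xv => h2.
have h3 := rdot_ge_norm W vn.
have h4 : (1 - l2norm x) / (1 - s) * (rdot W v - l2norm x) ^+ 2 <= 4 * (1 - l2norm x) * 2.
  apply: le_trans (_ : (1 - l2norm x) / (1 - s) * sqmod (hdot (W - x) v) <= _).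
    by rewrite ler_wpM2l // divr_ge0 // ltW.
  apply: le_trans h1 _; rewrite ler_wpM2l ?mulr_ge0 // ?(ltW e0) //.
  by lra.
rewrite -[l2norm x - _]opprB sqrrN.
have k0 : 0 < (1 - l2norm x) / (1 - s) by rewrite divr_gt0.
rewrite -(ler_pM2l k0); apply: le_trans h4 _.
have -> : (1 - l2norm x) / (1 - s) * (8 * (1 - s)) = 4 * (1 - l2norm x) * 2.
  by field; rewrite gt_eqF.
by [].
Qed.

(** Here [zeta] is a cluster point of fixed points of dampings towards 0 with parameters tending to
    0. The damping is chosen after [j], while the bound of [fixpoint_horoball] is independent of
    both, so it survives in the limit. *)
Lemma exists_horoball_center F : contractive F ->
  (forall x, l2norm x < 1 -> F x <> x) ->
  exists2 zeta, l2norm zeta = 1 & forall s j, 0 < s < 1 ->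
    1 - rdot (iter j F (s%:C *: zeta)) zeta <= Num.sqrt (8 * (1 - s)).
Proof.
move=> FC nofix; pose t (k : nat) : R := k.+1%:R^-1.
have t01 k : 0 < t k <= 1 by rewrite /t invr_gt0 ltr0n invf_le1 ?ltr0n //= ler1n.
have t01' k : 0 <= t k <= 1 by case/andP: (t01 k) => /ltW -> ->.
have tsmall e : 0 < e -> exists N, forall k, (N <= k)%N -> t k < e.
  move=> e0; have [N hN] := exists_nat_gt e^-1; exists N => k Nk.
  rewrite -[e]invrK ltf_pV2 ?posrE ?invr_gt0 ?ltr0n //.
  by apply: lt_le_trans hN _; rewrite ler_nat; apply: leq_trans Nk _.
have o1 : l2norm (0 : 'rV[C]_d) < 1 by rewrite l2norm0.
have /choice[x hx] : forall k, exists x, l2norm x < 1 /\ damped F (t k) 0 x = x.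
  by move=> k; have [x [? ? _]] := damped_fixpoint FC (t01 k) o1; exists x.
have x1 k := (hx k).1; have fx k := (hx k).2.
(* A fixed point of the damping is moved by [F] by less than [t k], which [displacement_bound]
   forbids inside a fixed ball once [t k] is small. *)
have xlim rho : rho < 1 -> exists N, forall k, (N <= k)%N -> rho < l2norm (x k).
  move=> rho1; have [mu mu0 hmu] := displacement_bound FC nofix rho1.
  have [N hN] := tsmall mu mu0; exists N => k Nk; rewrite ltNge; apply/negP => h.
  suff hm : l2norm (F (x k) - x k) < mu by have := le_lt_trans (hmu _ h) hm; rewrite ltxx.
  apply: le_lt_trans _ (hN k Nk).
  have tk0 : 0 <= t k by case/andP: (t01' k).
  have -> : F (x k) - x k = (t k)%:C *: F (x k).
    rewrite -[X in _ - X]fx damped0E rmorphB (rmorph1 (real_complex R)).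
    by rewrite scalerBl scale1r opprB addrC subrK.
  by rewrite l2normZ // ler_piMr // ltW // FC.1.
have [zeta [z1 cl]] := l2_bolzano_weierstrass (fun k => ltW (x1 k)).
have zn : l2norm zeta = 1.
  apply/le_anti; rewrite z1 /=; apply/ler_addgt0Pr => e e0.
  have e20 : 0 < e / 2 by rewrite divr_gt0.
  have [|N hN] := xlim (1 - e / 2); first by lra.
  have [k Nk hk] := cl _ e20 N.
  have := hN k Nk; have := l2normB_le (x k) zeta; lra.
exists zeta => // s j /andP[s0 s1]; apply/ler_addgt0Pr => e e0.
set w := s%:C *: zeta.
have w1 : l2norm w < 1 by rewrite /w l2normZ ?(ltW s0) // zn mulr1.
have e20 : 0 < e / 2 by rewrite divr_gt0.
have [dl dl0 hdl] := damped_iter_cvg j FC w1 e20.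
have [N1 hN1] := tsmall _ dl0; have [N2 hN2] := xlim 0 ltr01.
(* The bound [1 - s] is the closeness required by [fixpoint_horoball]; [e / 6] absorbs the factor 3
   of [one_sub_rdot_le]. *)
pose e' := Num.min (1 - s) (e / 6).
have e'0 : 0 < e' by rewrite lt_min subr_gt0 s1 divr_gt0.
have [k kN hk] := cl _ e'0 (maxn N1 N2).
move: kN; rewrite geq_max => /andP[k1 k2].
have x0 := hN2 k k2.
move: hk; rewrite lt_min => /andP[hk1 hk2].
have s01 : 0 < s < 1 by rewrite s0 s1.
have hA := fixpoint_horoball j FC (t01' k) x0 (x1 k) (fx k) zn s01 (ltW hk1).
have hB := hdl _ (t01' k) (ltW (hN1 k k1)).
have W1 : l2norm (iter j (damped F (t k) 0) w) < 1.
  by elim: (j) => [|i IH] //; rewrite iterS; exact: damped_ball1.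
have hC := one_sub_rdot_le zn x0 (x1 k) W1 (iter j F w).
apply: le_trans hC _; rewrite -addrA; apply: lerD; last first.
  by apply: (@le_trans _ _ (3 * (e / 6) + e / 2)); [apply: lerD => //; lra | lra].
apply: le_trans (ler_norm _) _; rewrite -sqrtr_sqr; exact: ler_wsqrtr.
Qed.

(** Testing with [u / |u|], the small factor [1 - |u|] forces [rdot W v] close to [|u|], so [W], of
    norm less than 1, is close to [u]. *)
Lemma linked_near c u W delta : 0 < c -> 0 < l2norm u -> l2norm u < 1 -> l2norm W < 1 ->
  1 - l2norm u <= delta -> linked c u W ->
  normsq (W - u) <= 4 * delta + 2 * (Num.sqrt (8 * delta) / c).
Proof.
move=> c0 u0 u1 W1 hu h; set v := (l2norm u)^-1%:C *: u.
have vn : normsq v <= 1.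
  by rewrite /v normsqZ sqmod_real -sqr_l2norm -exprMn mulVf ?gt_eqF // expr1n.
have uv : rdot u v = l2norm u.
  by rewrite /v rdotZr -/(normsq u) -sqr_l2norm expr2 mulKf ?gt_eqF.
have Wu : rdot W u = l2norm u * rdot W v by rewrite /v rdotZr mulVKf ?gt_eqF.
have h2 := sqr_rdot_le (W - u) v; rewrite rdotBl uv in h2.
have := h v vn; rewrite uv => h1.
have h3 := rdot_ge_norm W vn; have h4 := rdot_le_norm W vn.
have h5 : (c * (l2norm u - rdot W v)) ^+ 2 <= 8 * delta.
  rewrite exprMn -[l2norm u - _]opprB sqrrN.
  apply: le_trans (_ : c ^+ 2 * sqmod (hdot (W - u) v) <= _).
    by rewrite ler_wpM2l ?sqr_ge0.
  apply: le_trans h1 _.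
  have : (1 - l2norm u) * (1 - rdot W v) <= delta * 2.
    by apply: ler_pM; lra.
  by lra.
have h6 : l2norm u - rdot W v <= Num.sqrt (8 * delta) / c.
  rewrite ler_pdivlMr // mulrC; apply: le_trans (ler_norm _) _.
  by rewrite -sqrtr_sqr; exact: ler_wsqrtr.
rewrite normsqB Wu -!sqr_l2norm.
move: (l2norm u) (rdot W v) (l2norm W) (l2norm_ge0 W) u0 u1 W1 hu h6 => a b q.
have E0 : 0 <= Num.sqrt (8 * delta) / c by rewrite divr_ge0 ?sqrtr_ge0 // ltW.
move: (Num.sqrt _ / c) E0 => E E0 q0 a0 a1 q1 ha hE.
have hq : q ^+ 2 <= 1 by rewrite -(expr1n _ 2) ler_sqr ?nnegrE // ltW.
have hab : a * (a - b) <= E.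
  have [ab|ab] := lerP (a - b) 0; last first.
    by apply: le_trans hE; rewrite ler_piMl ?(ltW ab) ?(ltW a1).
  by apply: le_trans E0; rewrite pmulr_rle0.
have ha2 : (1 - a) * (1 + a) <= delta * 2 by apply: ler_pM; lra.
by lra.
Qed.

(* The orbits of [0] and [s zeta] become asymptotic, since linked points
   merge when one of them tends to the sphere; letting [s] tend to 1 makes
   the second orbit stay arbitrarily close to [zeta]. *)
Lemma iter0_cvg F : contractive F -> (forall x, l2norm x < 1 -> F x <> x) ->
  exists2 zeta, l2norm zeta = 1 & forall e, 0 < e ->
    exists N, forall k, (N <= k)%N -> l2norm (iter k F 0 - zeta) <= e.
Proof.
move=> FC nofix; have [zeta zn hz] := exists_horoball_center FC nofix.
exists zeta => // e e0.
(* If [1 - rdot W zeta <= eta] then [|W - zeta|^2 <= 2 eta = (e / 4)^2]; [r] is chosen so that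
   [sqrt (8 r) <= eta]. *)
pose eta := e ^+ 2 / 32; have eta0 : 0 < eta by rewrite divr_gt0 // exprn_gt0.
pose r := Num.min (1 / 2) (eta ^+ 2 / 8); pose s := 1 - r.
have r0 : 0 < r by rewrite lt_min !divr_gt0 ?exprn_gt0.
have r12 : r <= 1 / 2 by rewrite /r ge_min lexx.
have re : r <= eta ^+ 2 / 8 by rewrite /r ge_min lexx orbT.
have s01 : 0 < s < 1 by rewrite /s; apply/andP; split; lra.
have /andP[s0 s1] := s01.
set w := s%:C *: zeta.
have wn : l2norm w = s by rewrite /w l2normZ ?(ltW s0) // zn mulr1.
have w1 : l2norm w < 1 by rewrite wn.
have o1 : l2norm (0 : 'rV[C]_d) < 1 by rewrite l2norm0.
have near_zeta k : l2norm (iter k F w - zeta) <= e / 4.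
  have W1 : l2norm (iter k F w) < 1 by exact: (contractive_iter k FC).1.
  have := hz s k s01; rewrite -/w.
  have hs : Num.sqrt (8 * (1 - s)) <= eta.
    have -> : eta = Num.sqrt (eta ^+ 2) by rewrite sqrtr_sqr gtr0_norm.
    by apply: ler_wsqrtr; rewrite /s; lra.
  rewrite l2norm_le ?divr_ge0 ?(ltW e0) // normsqB -!sqr_l2norm zn.
  have : l2norm (iter k F w) ^+ 2 <= 1.
    by rewrite -(expr1n _ 2) ler_sqr ?nnegrE ?l2norm_ge0 // ltW.
  move: (l2norm _ ^+ 2) (rdot _ _) (Num.sqrt _) hs => a b q; rewrite /eta; lra.
have r0' : 0 < 1 - s by rewrite /s; lra.
have link0 : linked r 0 w.
  apply: (@linked_of_dist _ _ _ s); rewrite ?l2norm0 ?wn ?(ltW r0) ?(ltW s0) ?(ltW s1) //.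
  rewrite subr0 wn /s; have : r * (1 - r) <= r * 2 by rewrite ler_wpM2l ?(ltW r0) //; lra.
  by lra.
(* The bound [1 / 2] keeps the orbit of 0 away from 0; the other two make each term in [linked_near]
   at most [e^2 / 32]. *)
pose delta := Num.min (1 / 2) (Num.min (e ^+ 2 / 128) ((r * (e ^+ 2 / 64)) ^+ 2 / 8)).
have delta0 : 0 < delta.
  by rewrite !lt_min !divr_gt0 // exprn_gt0 // mulr_gt0 // divr_gt0 // exprn_gt0.
have d1 : delta <= 1 / 2 by rewrite /delta !ge_min lexx.
have d2 : delta <= e ^+ 2 / 128 by rewrite /delta !ge_min lexx orbT.
have d3 : delta <= (r * (e ^+ 2 / 64)) ^+ 2 / 8 by rewrite /delta !ge_min lexx !orbT.
have [|N hN] := @orbit_escapes _ _ F 0 (1 - delta) FC nofix; first by lra.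
exists N => k Nk.
have u1 : l2norm (iter k F 0) < 1 by exact: (contractive_iter k FC).1.
have W1 : l2norm (iter k F w) < 1 by exact: (contractive_iter k FC).1.
have link := (contractive_iter k FC).2 _ _ _ (ltW r0) o1 w1 link0.
have hu := hN k Nk.
have u0 : 0 < l2norm (iter k F 0) by apply: lt_trans hu; lra.
have hu' : 1 - l2norm (iter k F 0) <= delta by rewrite lerBlDl -lerBlDr ltW.
have := linked_near r0 u0 u1 W1 hu' link.
have hq : Num.sqrt (8 * delta) / r <= e ^+ 2 / 64.
  rewrite ler_pdivrMr // [leRHS]mulrC.
  have -> : r * (e ^+ 2 / 64) = Num.sqrt ((r * (e ^+ 2 / 64)) ^+ 2).
    by rewrite sqrtr_sqr gtr0_norm // mulr_gt0 // divr_gt0 // exprn_gt0.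
  by apply: ler_wsqrtr; lra.
move=> hn; apply: le_trans (l2dist_triangle _ (iter k F w) _) _.
have h4 : l2norm (iter k F 0 - iter k F w) <= e / 4.
  rewrite l2distC l2norm_le ?divr_ge0 ?(ltW e0) //.
  move: hn; move: (normsq _) => n hn; lra.
by apply: le_trans (lerD h4 (near_zeta k)) _; lra.
Qed.

End Boundary.

(** * Sesquilinear forms of matrices and polarization *)

Section MatrixForms.
Context {R : realType}.
Local Notation C := R[i].

Definition mxform {n} (A : 'M[C]_n) (a b : 'cV[C]_n) : C := (a ^t* *m A *m b) 0 0.
Definition colnormsq {n} (a : 'cV[C]_n) : R := \sum_(i < n) sqmod (a i 0).

Section OneSize.
Context {n : nat}.
Implicit Types (A B : 'M[C]_n) (a b v : 'cV[C]_n).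

Lemma mxformDm A B a b : mxform (A + B) a b = mxform A a b + mxform B a b.
Proof. by rewrite /mxform mulmxDr mulmxDl mxE. Qed.

Lemma mxformZm (c : C) A a b : mxform (c *: A) a b = c * mxform A a b.
Proof. by rewrite /mxform -scalemxAr -scalemxAl mxE. Qed.

Lemma mxformBm A B a b : mxform (A - B) a b = mxform A a b - mxform B a b.
Proof. by rewrite mxformDm -scaleN1r mxformZm mulN1r. Qed.

Lemma mxform_sum d (A : 'I_d -> 'M[C]_n) a b :
  mxform (\sum_(j < d) A j) a b = \sum_(j < d) mxform (A j) a b.
Proof. by rewrite /mxform mulmx_sumr mulmx_suml summxE. Qed.

Lemma mxformDr A a b b' : mxform A a (b + b') = mxform A a b + mxform A a b'.
Proof. by rewrite /mxform mulmxDr mxE. Qed.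

Lemma mxformZr A a b (c : C) : mxform A a (c *: b) = c * mxform A a b.
Proof. by rewrite /mxform -scalemxAr mxE. Qed.

Lemma mxformDl A a a' b : mxform A (a + a') b = mxform A a b + mxform A a' b.
Proof. by rewrite /mxform linearD /= map_mxD !mulmxDl mxE. Qed.

Lemma mxformZl A a b (c : C) : mxform A (c *: a) b = c^* * mxform A a b.
Proof. by rewrite /mxform linearZ /= map_mxZ -!scalemxAl mxE. Qed.

Lemma mxform_adj A a b : mxform (A ^t*) a b = (mxform A b a)^*.
Proof.
rewrite /mxform -[RHS](mxE map_mx_key (fun i j => ((b ^t* *m A *m a) i j)^*)).
have -> : (a ^t* *m A ^t* *m b) = (b ^t* *m A *m a) ^t*.
  have bK : (b ^t* ) ^t* = b by apply/matrixP => i j; rewrite !mxE conjCK.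
  by rewrite !trmx_mul !map_mxM bK mulmxA.
by rewrite !mxE.
Qed.

Lemma mxform1E a b : mxform 1%:M a b = \sum_i (a i 0)^* * b i 0.
Proof. by rewrite /mxform mulmx1 mxE; apply: eq_bigr => i _; rewrite !mxE. Qed.

Lemma mxform1 a : mxform 1%:M a a = (colnormsq a)%:C.
Proof.
by rewrite mxform1E rmorph_sum; apply: eq_bigr => i _; rewrite /= -mulrJ_sqmod.
Qed.

Lemma mxform_scalar (c : C) a b : mxform c%:M a b = c * mxform 1%:M a b.
Proof. by rewrite -mxformZm scalemx1. Qed.

Lemma colnormsq_ge0 a : 0 <= colnormsq a.
Proof. by rewrite sumr_ge0 // => i _; exact: sqmod_ge0. Qed.

Lemma colnormsq_gt0 a : a != 0 -> 0 < colnormsq a.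
Proof.
move=> an0; rewrite lt0r colnormsq_ge0 andbT; apply: contra_neq an0.
move=> /eqP; rewrite psumr_eq0; last by move=> i _; exact: sqmod_ge0.
move=> /allP h; apply/colP => i; rewrite mxE.
have := h i (mem_index_enum _); rewrite /sqmod /= paddr_eq0 ?sqr_ge0 // !sqrf_eq0.
by case: (a i 0) => x y /= /andP[/eqP-> /eqP->].
Qed.

Lemma colnormsq0 : colnormsq (0 : 'cV[C]_n) = 0.
Proof. by rewrite /colnormsq big1 // => i _; rewrite mxE /sqmod /= expr0n addr0. Qed.

Lemma colnormsqZ (c : C) a : colnormsq (c *: a) = sqmod c * colnormsq a.
Proof. by rewrite mulr_sumr; apply: eq_bigr => i _; rewrite mxE sqmodM. Qed.

Lemma colnormsq_parallelogram a b :
  colnormsq (a + b) + colnormsq (a - b) = 2 * (colnormsq a + colnormsq b).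
Proof.
rewrite /colnormsq -!big_split mulr_sumr; apply: eq_bigr => i _.
by rewrite !mxE /sqmod /= !complex_ReD !complex_ImD complex_ReN complex_ImN; ring.
Qed.

Lemma mxform_polarization A a b :
  4 * mxform A a b = mxform A (a + b) (a + b) - mxform A (a - b) (a - b)
    - 'i * (mxform A (a + 'i *: b) (a + 'i *: b) - mxform A (a - 'i *: b) (a - 'i *: b)).
Proof.
(* The identity is isolated in a commutative ring with [I * I = -1], with the four values of the
   form as variables. *)
have polar (K : comNzRingType) (p q r t I s1 s2 s3 s4 : K) : I * I = -1 ->
    s1 = p + 1 * q + 1 * r + 1 * 1 * t -> s2 = p + -1 * q + -1 * r + -1 * -1 * t ->
    s3 = p + I * q + - I * r + - I * I * t ->
    s4 = p + - I * q + I * r + I * - I * t ->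
    4 * q = s1 - s2 - I * (s3 - s4).
  move=> I2 -> -> -> ->; apply/eqP; rewrite -subr_eq0; apply/eqP.
  transitivity (2 * (I * I + 1) * (q - r)); first by ring.
  by rewrite I2 addNr mulr0 mul0r.
have expand v (c c' : C) : v = a + c *: b -> c^* = c' -> mxform A v v =
    mxform A a a + c * mxform A a b + c' * mxform A b a + c' * c * mxform A b b.
  move=> -> <-; rewrite mxformDl mxformDr mxformDr mxformZr mxformZl mxformZl mxformZr.
  by rewrite -mulrA addrA.
apply: (polar _ _ _ (mxform A b a) (mxform A b b)).
- by rewrite -expr2 sqrCi.
- by apply: expand; rewrite ?scale1r ?rmorph1.
- by apply: expand; rewrite ?scaleN1r // rmorphN rmorph1.
- by apply: expand; rewrite ?conjCi.
- by apply: expand; rewrite ?scaleNr // rmorphN /= conjCi opprK.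
Qed.

(** Polarization expresses the off-diagonal value by four diagonal ones, whose bounds add up by the
    parallelogram law. *)
Lemma mxform_numerical_radius A (r : R) a b :
  (forall v, `|mxform A v v| <= (r * colnormsq v)%:C) ->
  `|mxform A a b| <= (r * (colnormsq a + colnormsq b))%:C.
Proof.
move=> h; rewrite -(ler_pM2l (x := 4)) ?ltr0n //.
have -> : 4 * `|mxform A a b| = `|4 * mxform A a b|.
  by rewrite normrM (ger0_norm (ler0n _ 4)).
rewrite mxform_polarization.
apply: le_trans (ler_normB _ _) _.
apply: (@le_trans _ _ ((r * colnormsq (a + b))%:C + (r * colnormsq (a - b))%:C +
   ((r * colnormsq (a + 'i *: b))%:C + (r * colnormsq (a - 'i *: b))%:C))).
  apply: lerD; first by apply: le_trans (ler_normB _ _) _; apply: lerD; apply: h.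
  rewrite normrM normCi mul1r.
  by apply: le_trans (ler_normB _ _) _; apply: lerD; apply: h.
rewrite -!rmorphD /= -!mulrDr !colnormsq_parallelogram colnormsqZ.
have -> : sqmod ('i : C) = 1.
  by apply: (@complexI R); rewrite sqmodE normCi expr1n.
rewrite -(rmorph_nat (real_complex R)) -rmorphM /= lec_real.
by lra.
Qed.

End OneSize.

Section Blocks.
Context {m n : nat}.

Lemma colnormsq_col (a : 'cV[C]_m) (b : 'cV[C]_n) :
  colnormsq (col_mx a b) = colnormsq a + colnormsq b.
Proof.
rewrite /colnormsq big_split_ord /=; congr (_ + _); apply: eq_bigr => i _.
  by rewrite col_mxEu.
by rewrite col_mxEd.
Qed.

End Blocks.

Lemma mxform_block {m n : nat} (A : 'M[C]_m) (B : 'M[C]_(m, n)) (D : 'M[C]_n) a b :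
  mxform (block_mx A B 0 D) (col_mx a b) (col_mx a b) =
  mxform A a a + (a ^t* *m B *m b) 0 0 + mxform D b b.
Proof.
rewrite /mxform tr_col_mx map_row_mx mul_row_block mulmx0 addr0 mul_row_col.
by rewrite mulmxDl !mxE addrA.
Qed.

End MatrixForms.

(** * The matrix ball through numerical ranges; values of nc maps at triangular points *)

Section MatrixBallForms.
Context {R : realType} {d : nat}.
Local Notation C := R[i].
Local Notation Mx n := (mxtuple R d n).

(** For unit vectors [a = b] this runs through the joint numerical range of [X]. *)
Definition formvec {n} (X : Mx n) (a b : 'cV[C]_n) : 'rV[C]_d :=
  \row_j mxform (X 0 j) a b.

Lemma rdot_formvec {n} (X : Mx n) (v : 'cV[C]_n) (w : 'rV[C]_d) :
  rdot (formvec X v v) w = complex.Re (mxform (\sum_(j < d) (w 0 j)^* *: X 0 j) v v).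
Proof.
rewrite /rdot /hdot mxform_sum; congr complex.Re; apply: eq_bigr => j _.
by rewrite mxE mxformZm mulrC.
Qed.

Lemma mxform_Remx {n} (A : 'M[C]_n) (v : 'cV[C]_n) :
  mxform (Remx A) v v = (complex.Re (mxform A v v))%:C.
Proof.
rewrite /Remx mxformZm mxformDm mxform_adj; case: (mxform A v v) => x y.
rewrite complex_conjE /=; apply/eqP.
rewrite -(inj_eq (mulfI (_ : 2 != 0 :> C))) ?pnatr_eq0 //.
rewrite mulrA mulfV ?pnatr_eq0 // mul1r.
by rewrite -(rmorph_nat (real_complex R)) eq_complex /=; apply/andP; split; apply/eqP; ring.
Qed.

(** The matrix is always hermitian, so only the sign of its real quadratic form matters. *)
Lemma posdefmx_sub_Remx {n} (A : 'M[C]_n) : posdefmx (1%:M - Remx A) <->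
  forall v : 'cV[C]_n, v != 0 -> complex.Re (mxform A v v) < colnormsq v.
Proof.
have E v : ((v ^t*) *m (1%:M - Remx A) *m v) 0 0 =
    (colnormsq v - complex.Re (mxform A v v))%:C.
  rewrite -/(mxform _ v v) mxformBm mxform1 mxform_Remx.
  by rewrite rmorphB.
split=> [[_ h] v v0|h].
  by have := h v v0; rewrite E -[0]/(0%:C) ltc_real subr_gt0.
split=> [|v v0]; last by rewrite E -[0]/(0%:C) ltc_real subr_gt0 h.
apply/is_hermitianmxP; rewrite expr0 scale1r; apply/matrixP => i j.
rewrite !mxE rmorphB rmorphM rmorphD /= conjCK [X in _ = _ - _ * X]addrC.
by rewrite rmorph_nat fmorphV rmorph_nat eq_sym.
Qed.

Lemma enorm_le1 (w : 'rV[C]_d) : (enorm w <= 1) = (normsq w <= 1).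
Proof. by rewrite enormE -[1]/(1%:C) lec_real l2norm_le ?ler01 // expr1n. Qed.

Lemma maxballP {n} (X : Mx n) : maxball n X <->
  forall w, normsq w <= 1 -> forall v, v != 0 -> rdot (formvec X v v) w < colnormsq v.
Proof.
split=> h w; rewrite -?enorm_le1 => w1.
  by move=> v v0; rewrite rdot_formvec; move/posdefmx_sub_Remx: (h w w1); apply.
by apply/posdefmx_sub_Remx => v v0; rewrite -rdot_formvec h // -enorm_le1.
Qed.

Lemma maxball_le {n} (X : Mx n) w v : maxball n X -> normsq w <= 1 ->
  rdot (formvec X v v) w <= colnormsq v.
Proof.
move=> /maxballP XB w1; have [->|v0] := eqVneq v 0; last exact/ltW/XB.
rewrite rdot_formvec /mxform mulmx0 mxE /= colnormsq_ge0 //.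
Qed.

(** The corner is a multiple of [Y - X] exactly so that a shear diagonalizes the block point, see
    [triangularE]. *)
Definition triangular {n} (c : C) (X Y : Mx n) : Mx (n + n) :=
  \row_j block_mx (X 0 j) (c *: (Y 0 j - X 0 j)) 0 (Y 0 j).

Lemma formvec_triangular {n} c (X Y : Mx n) a b :
  formvec (triangular c X Y) (col_mx a b) (col_mx a b) =
  formvec X a a + formvec Y b b + c *: (formvec Y a b - formvec X a b).
Proof.
apply/rowP => j; rewrite !mxE mxform_block -/(mxform _ a b) mxformZm mxformBm.
by rewrite addrAC.
Qed.

Lemma formvec_scalar {n} (z : 'rV[C]_d) (a b : 'cV[C]_n) :
  formvec (scalar_mxtuple n z) a b = mxform 1%:M a b *: z.
Proof. by apply/rowP => j; rewrite !mxE mxform_scalar mulrC. Qed.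

Lemma maxball_dsum {m n} (X : Mx m) (Y : Mx n) : maxball m X -> maxball n Y ->
  maxball (m + n) (mxtuple_dsum X Y).
Proof.
move=> XB YB; apply/maxballP => w w1 v; rewrite -[v]vsubmxK.
move: (usubmx v) (dsubmx v) => a b ab0.
have -> : formvec (mxtuple_dsum X Y) (col_mx a b) (col_mx a b) =
    formvec X a a + formvec Y b b.
  by apply/rowP => j; rewrite !mxE mxform_block mulmx0 mul0mx mxE addr0.
rewrite rdotDl colnormsq_col.
have [a0|a0] := eqVneq a 0; last first.
  by apply: ltr_leD; [exact: (maxballP X).1 | exact: maxball_le].
have [b0|b0] := eqVneq b 0; first by rewrite a0 b0 col_mx0 eqxx in ab0.
by apply: ler_ltD; [exact: maxball_le | exact: (maxballP Y).1].
Qed.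

Section Shear.
Context {n : nat}.

Definition shear (c : C) : 'M[C]_(n + n) := block_mx 1%:M (- c%:M) 0 1%:M.

Lemma shear_unit c : shear c \in unitmx.
Proof. by rewrite unitmxE det_ublock !det1 mulr1 unitr1. Qed.

Lemma invmx_shear c : invmx (shear c) = block_mx 1%:M c%:M 0 1%:M.
Proof.
have h : shear c *m block_mx 1%:M c%:M 0 1%:M = 1%:M.
  rewrite mulmx_block !mulmx1 !mul1mx !mulmx0 !mul0mx !addr0 add0r subrr.
  by rewrite -scalar_mx_block.
by rewrite -[RHS](mulKmx (shear_unit c)) h mulmx1.
Qed.

Lemma triangularE c (X Y : Mx n) :
  triangular c X Y = mxtuple_conj (shear c) (mxtuple_dsum X Y).
Proof.
apply/rowP => j; rewrite !mxE invmx_shear.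
move: (X 0 j) (Y 0 j) => A B.
rewrite mulmx_block !mul1mx !mul0mx !mulmx0 !addr0 !add0r.
rewrite mulmx_block !mul0mx !mulmx1 !mulmx0 !addr0 mulmxN mul_mx_scalar mul_scalar_mx.
by rewrite add0r scalerBr addrC.
Qed.

End Shear.

(** Similarity to the direct sum, which lies in the ball as well, as the similarity axiom
    requires. *)
Lemma nc_triangular (f : forall n, Mx n -> Mx n) n c (X Y : Mx n) : nc_self_map f -> (0 < n)%N ->
  maxball n X -> maxball n Y -> maxball (n + n) (triangular c X Y) ->
  f (n + n)%N (triangular c X Y) = triangular c (f n X) (f n Y).
Proof.
move=> [_ fD fS] n0 XB YB; rewrite !triangularE => TB.
have nn0 : (0 < n + n)%N by rewrite addn_gt0 n0.
rewrite (fS _ _ _ nn0 (shear_unit c) (maxball_dsum XB YB) TB).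
by rewrite (fD _ _ _ _ n0 n0 XB YB).
Qed.

(** Lets one-step estimates apply to every iterate with the same constants. *)
Lemma nc_self_map_iter (f : forall n, Mx n -> Mx n) k : nc_self_map f -> nc_self_map (fun n => iter k (f n)).
Proof.
move=> [fB fD fS]; elim: k => [|k [gB gD gS]].
  by split=> [n X _ XB|m n X Y _ _ _ _|n S X _ _ _ _]; [exact: XB|reflexivity..].
split=> [n X n0 XB|m n X Y m0 n0 XB YB|n S X n0 Su XB SB]; rewrite /=.
- exact: fB n _ n0 (gB n X n0 XB).
- rewrite (gD _ _ _ _ m0 n0 XB YB).
  exact: fD _ _ _ _ m0 n0 (gB _ _ m0 XB) (gB _ _ n0 YB).
- have := gB _ _ n0 SB; rewrite (gS _ _ _ n0 Su XB SB).
  exact: fS _ _ _ n0 Su (gB _ _ n0 XB).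
Qed.

Lemma scalar_mxtuple_entries (X : Mx 1) :
  scalar_mxtuple 1 (map_mx (fun A : 'M[C]_1 => A 0 0) X) = X.
Proof. by apply/rowP => j; rewrite !mxE -mx11_scalar. Qed.

Lemma level1E (f : forall n, Mx n -> Mx n) z : scalar_mxtuple 1 (level1 f z) = f 1%N (scalar_mxtuple 1 z).
Proof. exact: scalar_mxtuple_entries. Qed.

Lemma scalar_mxtupleK (z : 'rV[C]_d) :
  map_mx (fun A : 'M[C]_1 => A 0 0) (scalar_mxtuple 1 z) = z.
Proof. by apply/rowP => j; rewrite !mxE eqxx mulr1n. Qed.

Lemma level1_iter (f : forall n, Mx n -> Mx n) k z : level1 (fun n => iter k (f n)) z = iter k (level1 f) z.
Proof.
elim: k => [|k IH]; first exact: scalar_mxtupleK.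
rewrite iterS -IH; set g := fun n => iter k (f n).
transitivity (map_mx (fun A : 'M[C]_1 => A 0 0) (f 1%N (g 1%N (scalar_mxtuple 1 z)))) => //.
by rewrite -level1E.
Qed.

(** Induction on the size, splitting off one 1 x 1 block at a time. *)
Lemma nc_scalar (f : forall n, Mx n -> Mx n) n (z : 'rV[C]_d) : nc_self_map f -> (0 < n)%N ->
  (forall m, (0 < m)%N -> maxball m (scalar_mxtuple m z)) ->
  f n (scalar_mxtuple n z) = scalar_mxtuple n (level1 f z).
Proof.
move=> [fB fD fS] + zB; case: n => // n _; elim: n => [|n IH]; first by rewrite level1E.
have split (u : 'rV[C]_d) : scalar_mxtuple n.+2 u =
    mxtuple_dsum (scalar_mxtuple 1 u) (scalar_mxtuple n.+1 u).
  by apply/rowP => j; rewrite !mxE; exact: (@scalar_mx_block _ 1 n.+1).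
transitivity (mxtuple_dsum (f 1%N (scalar_mxtuple 1 z)) (f n.+1 (scalar_mxtuple n.+1 z))).
  rewrite split; exact (fD 1%N n.+1 _ _ isT isT (zB 1%N isT) (zB n.+1 isT)).
by rewrite IH -level1E split.
Qed.

Lemma scalar_mxtuple_maxball n (z : 'rV[C]_d) : l2norm z < 1 ->
  maxball n (scalar_mxtuple n z).
Proof.
move=> z1; apply/maxballP => w w1 v v0.
rewrite formvec_scalar mxform1 rdotZl gtr_pMr ?colnormsq_gt0 //.
by apply: le_lt_trans z1; exact: rdot_le_norm.
Qed.

Lemma maxball1_l2norm (z : 'rV[C]_d) : maxball 1 (scalar_mxtuple 1 z) -> l2norm z < 1.
Proof.
move=> /maxballP zB; have [w [w1 <-]] := exists_rdot_eq_l2norm z.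
have v0 : (1%:M : 'M[C]_1) != 0 by rewrite -mxrank_eq0 mxrank1.
have := zB w w1 _ v0; rewrite formvec_scalar mxform1 rdotZl.
by rewrite gtr_pMr // colnormsq_gt0.
Qed.

End MatrixBallForms.

(** * Contraction at level 1 and the Harnack inequality at higher levels *)

Section NcContraction.
Context {R : realType} {d : nat}.
Local Notation C := R[i].
Local Notation Mx n := (mxtuple R d n).
Implicit Types (f : forall n, Mx n -> Mx n) (z w u : 'rV[C]_d).

(** From [4 P Q <= (P + Q)^2]; the factor [th < 1] provides strictness. *)
Lemma oppRe_lt_of_sqmod_le (x : C) (P Q : R) : 0 <= P -> 0 <= Q -> 0 < P + Q ->
  forall th, 0 <= th < 1 -> sqmod x <= th ^+ 2 * (4 * P * Q) -> - complex.Re x < P + Q.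
Proof.
move=> P0 Q0 PQ th /andP[t0 t1] h; have h1 := sqr_Re_le_sqmod x.
have h2 : th ^+ 2 * (4 * P * Q) <= th ^+ 2 * (P + Q) ^+ 2.
  by rewrite ler_wpM2l ?sqr_ge0 //; have := sqr_ge0 (P - Q); lra.
have h3 : (complex.Re x) ^+ 2 <= (th * (P + Q)) ^+ 2 by rewrite exprMn; lra.
have h4 : - complex.Re x <= th * (P + Q).
  apply: le_trans (ler_norm _) _; rewrite normrN.
  rewrite -(@ler_sqr R) ?nnegrE ?mulr_ge0 // ?(ltW PQ) // real_normK ?num_real //.
by apply: le_lt_trans h4 _; rewrite gtr_pMl.
Qed.

Lemma rdot_triangular_scalar (c : R) z w u (a b : 'cV[C]_1) :
  rdot (formvec (triangular c%:C (scalar_mxtuple 1 z) (scalar_mxtuple 1 w))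
     (col_mx a b) (col_mx a b)) u =
  colnormsq a * rdot z u + colnormsq b * rdot w u +
  c * complex.Re (mxform 1%:M a b * hdot (w - z) u).
Proof.
rewrite formvec_triangular !formvec_scalar !mxform1 -scalerBr.
by rewrite !rdotDl !rdotZl /rdot hdotZl.
Qed.

Lemma sqmod_mxform1 (a b : 'cV[C]_1) :
  sqmod (mxform 1%:M a b) = colnormsq a * colnormsq b.
Proof. by rewrite mxform1E /colnormsq !big_ord1 sqmodM sqmodJ. Qed.

(** Shrinking the constant by [th < 1] turns the weak inequality of the link into positive
    definiteness. *)
Lemma triangular_scalar_maxball c th z w : 0 <= c -> 0 <= th < 1 ->
  l2norm z < 1 -> l2norm w < 1 -> linked c z w ->
  maxball 2 (triangular (th * c)%:C (scalar_mxtuple 1 z) (scalar_mxtuple 1 w)).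
Proof.
move=> c0 th01 z1 w1 h; apply/maxballP => u u1 v.
rewrite -[v](@vsubmxK _ 1 1); move: (usubmx _) (dsubmx _) => a b ab0.
rewrite rdot_triangular_scalar (@colnormsq_col _ 1 1).
have := colnormsq_gt0 ab0; rewrite (@colnormsq_col _ 1 1).
have hu := h u u1.
have hz := rdot_le_norm z u1; have hw := rdot_le_norm w u1.
have a0 := colnormsq_ge0 a; have b0 := colnormsq_ge0 b => ab.
have P0 : 0 <= colnormsq a * (1 - rdot z u) by rewrite mulr_ge0 //; lra.
have Q0 : 0 <= colnormsq b * (1 - rdot w u) by rewrite mulr_ge0 //; lra.
have PQ : 0 < colnormsq a * (1 - rdot z u) + colnormsq b * (1 - rdot w u).
  have Az : 0 < 1 - rdot z u by lra.
  have Bw : 0 < 1 - rdot w u by lra.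
  have [a_gt0|a_le0] := ltrP 0 (colnormsq a).
    by apply: ltr_wpDr => //; apply: mulr_gt0.
  by apply: ltr_wpDl => //; apply: mulr_gt0 => //; lra.
set x := mxform 1%:M a b * hdot (w - z) u.
have := @oppRe_lt_of_sqmod_le (- (th * c)%:C * x) _ _ P0 Q0 PQ th th01.
rewrite mulNr complex_ReN opprK complex_ReZ => key.
suff : th * c * complex.Re x <
    colnormsq a * (1 - rdot z u) + colnormsq b * (1 - rdot w u) by lra.
apply: key.
have -> : sqmod (- ((th * c)%:C * x)) =
    th ^+ 2 * (colnormsq a * colnormsq b * (c ^+ 2 * sqmod (hdot (w - z) u))).
  rewrite -mulNr -rmorphN sqmodM sqmod_real /x sqmodM sqmod_mxform1.
  by ring.
rewrite ler_wpM2l ?sqr_ge0 //.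
apply: le_trans (_ : colnormsq a * colnormsq b * (4 * (1 - rdot z u) * (1 - rdot w u)) <= _).
  by rewrite ler_wpM2l // mulr_ge0.
by rewrite le_eqVlt; apply/orP; left; apply/eqP; ring.
Qed.

Lemma triangular_scalar_linked c z w :
  l2norm z < 1 -> l2norm w < 1 ->
  maxball 2 (triangular c%:C (scalar_mxtuple 1 z) (scalar_mxtuple 1 w)) -> linked c z w.
Proof.
move=> z1 w1 TB u u1.
have Az : 0 < 1 - rdot z u by have := rdot_le_norm z u1; lra.
have Bw : 0 < 1 - rdot w u by have := rdot_le_norm w u1; lra.
set g := hdot (w - z) u.
(* Up to scaling this vector minimizes the form in [a] for given [b], so its value exhibits the
   discriminant. *)
pose a : 'cV[C]_1 := (c%:C * g)%:M; pose b : 'cV[C]_1 := ((2 * (1 - rdot z u))%:C)%:M.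
have := maxball_le (col_mx a b) TB u1.
rewrite rdot_triangular_scalar (@colnormsq_col _ 1 1) -/g.
have -> : colnormsq a = c ^+ 2 * sqmod g.
  by rewrite /colnormsq big_ord1 /a mxE eqxx mulr1n sqmodM sqmod_real.
have -> : colnormsq b = (2 * (1 - rdot z u)) ^+ 2.
  by rewrite /colnormsq big_ord1 /b mxE eqxx mulr1n sqmod_real.
have -> : mxform 1%:M a b * g = (2 * (1 - rdot z u) * c * sqmod g)%:C.
  rewrite mxform1E big_ord1 /a /b !mxE !eqxx !mulr1n rmorphM /= conj_real_complex.
  rewrite mulrC !mulrA [g * _]mulrC -!mulrA [_ * (g * _)]mulrA.
  rewrite !rmorphM /= -mulrJ_sqmod; ring.
move=> h.
have : 0 <= (1 - rdot z u) * (4 * (1 - rdot z u) * (1 - rdot w u) - c ^+ 2 * sqmod g).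
  by rewrite /= in h; lra.
by rewrite pmulr_rge0 // subr_ge0.
Qed.

Lemma le_of_forall_sqr_lt1 (x y : R) :
  (forall th, 0 <= th < 1 -> th ^+ 2 * x <= y) -> x <= y.
Proof.
move=> h; have y0 : 0 <= y by have := h 0; rewrite expr0n mul0r; apply; rewrite lexx ltr01.
rewrite leNgt; apply/negP => yx; have x0 : 0 < x by lra.
(* With [th = 1 - q] the loss [2 q x] is only half of [x - y]. *)
pose q := (x - y) / (4 * x); have q0 : 0 < q by rewrite divr_gt0 ?subr_gt0 // mulr_gt0.
have q1 : q <= 1 / 4.
  by rewrite ler_pdivrMr ?mulr_gt0 //; lra.
have := h (1 - q); have -> : 0 <= 1 - q < 1 by apply/andP; split; lra.
move=> /(_ isT) h1.
have h2 : q * x = (x - y) / 4 by rewrite /q; field; rewrite gt_eqF.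
have : 0 <= q ^+ 2 * x by rewrite mulr_ge0 ?sqr_ge0 // ltW.
by move: h1; rewrite sqrrB expr1n; lra.
Qed.

(** A link gives triangular points of the ball with constant [th * c]; [f] keeps them triangular and
    in the ball, which links the images. Then [th] tends to 1. *)
Lemma contractive_level1 f : nc_self_map f -> contractive (level1 f).
Proof.
move=> f_nc; have [fB _ _] := f_nc.
have FB z : l2norm z < 1 -> l2norm (level1 f z) < 1.
  move=> z1; apply: maxball1_l2norm; rewrite level1E.
  exact: fB 1%N _ isT (scalar_mxtuple_maxball 1 z1).
split=> // c z w c0 z1 w1 h u u1.
apply: le_of_forall_sqr_lt1 => th th01.
have zB := scalar_mxtuple_maxball 1 z1.
have wB := scalar_mxtuple_maxball 1 w1.
have TB := triangular_scalar_maxball c0 th01 z1 w1 h.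
have TfB := fB (1 + 1)%N _ isT TB.
rewrite (@nc_triangular R d f 1 _ _ _ f_nc isT zB wB TB) -!level1E in TfB.
have := triangular_scalar_linked (FB z z1) (FB w w1) TfB u1.
by move=> hl; rewrite mulrA -exprMn.
Qed.

(** The joint numerical range lies in the closed ball of radius [rho], in homogeneous form. *)
Definition numerical_bound {n} (rho : R) (X : Mx n) : Prop :=
  forall v, l2norm (formvec X v v) <= rho * colnormsq v.

Lemma numerical_bound_form {n} rho (X : Mx n) w a b : numerical_bound rho X ->
  normsq w <= 1 -> `|hdot (formvec X a b) w| <= (rho * (colnormsq a + colnormsq b))%:C.
Proof.
move=> XB w1; set M := \sum_(j < d) (w 0 j)^* *: X 0 j.
have ME (s t : 'cV[C]_n) : hdot (formvec X s t) w = mxform M s t.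
  rewrite /hdot mxform_sum; apply: eq_bigr => j _.
  by rewrite mxE mxformZm mulrC.
rewrite ME; apply: mxform_numerical_radius => v; rewrite -ME.
rewrite -(@ler_pXn2r _ 2) ?nnegrE ?normr_ge0 //; last first.
  rewrite -[0]/(0%:C) lec_real; exact: le_trans (l2norm_ge0 _) (XB v).
rewrite -sqmodE -rmorphXn lec_real.
apply: le_trans (sqmod_hdot_le_normsq _ w1) _.
by rewrite -l2norm_le ?XB // (le_trans (l2norm_ge0 _) (XB v)).
Qed.

Lemma numerical_bound_maxball {n} rho (X : Mx n) : rho < 1 ->
  numerical_bound rho X -> maxball n X.
Proof.
move=> rho1 XB; apply/maxballP => w w1 v v0.
apply: le_lt_trans (rdot_le_norm _ w1) _; apply: le_lt_trans (XB v) _.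
by rewrite gtr_pMl // colnormsq_gt0.
Qed.

(** The diagonal leaves a margin of at least [(1 - rho) (|a|^2 + |b|^2)], and the corner, bounded by
    polarization, uses less than half of it. *)
Lemma triangular0_maxball {n} rho (X : Mx n) : 0 <= rho < 1 ->
  numerical_bound rho X ->
  maxball (n + n) (triangular ((1 - rho) / 2)%:C (scalar_mxtuple n 0) X).
Proof.
move=> /andP[rho0 rho1] XB.
have arith (A B p q : R) : p <= rho * B -> q <= rho * (A + B) -> 0 <= A -> 0 <= B ->
    0 < A + B -> p + (1 - rho) / 2 * q < A + B.
  move=> hp hq A0 B0 AB.
  have hq' : (1 - rho) / 2 * q <= (1 - rho) / 2 * (rho * (A + B)).
    by rewrite ler_wpM2l // divr_ge0 // subr_ge0 ltW.
  have h1 : 0 <= rho * A by rewrite mulr_ge0.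
  have h2 : 0 < (1 - rho) * (A + B) by rewrite mulr_gt0 // subr_gt0.
  have h3 : 0 <= (1 - rho) * ((1 - rho) * (A + B)) by rewrite mulr_ge0 ?subr_ge0 // ltW.
  by lra.
apply/maxballP => w w1 v.
rewrite -[v]vsubmxK; move: (usubmx _) (dsubmx _) => a b ab0.
have := colnormsq_gt0 ab0; rewrite colnormsq_col => ab.
rewrite formvec_triangular !formvec_scalar !scaler0 add0r subr0.
rewrite rdotDl rdotZl.
have h1 : rdot (formvec X b b) w <= rho * colnormsq b.
  exact: le_trans (rdot_le_norm _ w1) (XB b).
have h2 : rdot (formvec X a b) w <= rho * (colnormsq a + colnormsq b).
  have := numerical_bound_form a b XB w1 => h.
  apply: le_trans (ler_norm _) _; rewrite -lec_real.
  exact: le_trans (normc_ge_Re _) h.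
have a0 := colnormsq_ge0 a; have b0 := colnormsq_ge0 b.
exact: arith.
Qed.

(* A Harnack inequality for the function [1 - hdot (formvec (f n X) b b)
   zeta] of positive real part, read off from positivity on the vectors [(mu
   (s - e) b, b)]. *)
Lemma nc_harnack f n rho (X : Mx n) zeta b : nc_self_map f -> (0 < n)%N ->
  0 <= rho < 1 -> numerical_bound rho X -> normsq zeta <= 1 -> colnormsq b = 1 ->
  ((1 - rho) / 2) ^+ 2 *
    sqmod (hdot (formvec (f n X) b b) zeta - hdot (level1 f 0) zeta)
  <= 8 * (1 - rdot (level1 f 0) zeta).
Proof.
move=> f_nc n0 rho01 XB zn b1; have [fB _ _] := f_nc.
have o1 : l2norm (0 : 'rV[C]_d) < 1 by rewrite l2norm0.
have OB m : maxball m (scalar_mxtuple m (0 : 'rV[C]_d)) := scalar_mxtuple_maxball m o1.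
have XM : maxball n X by case/andP: rho01 => _ rho1; exact: numerical_bound_maxball XB.
have TB := triangular0_maxball rho01 XB.
have nn0 : (0 < n + n)%N by rewrite addn_gt0 n0.
have := fB _ _ nn0 TB.
rewrite (nc_triangular f_nc n0 (OB n) XM TB) (nc_scalar f_nc n0 (fun m _ => OB m)).
set c := (1 - rho) / 2; set y := level1 f 0; set Y := f n X => TfB.
have y1 : l2norm y < 1 by exact: (contractive_level1 f_nc).1.
set s := hdot (formvec Y b b) zeta; set e := hdot y zeta.
have YB : complex.Re s <= 1 /\ -1 <= complex.Re s.
  have YM := fB _ _ n0 XM.
  split; first by have := maxball_le b YM zn; rewrite b1.
  have zn' : normsq (- zeta) <= 1 by rewrite normsqN.
  by have := maxball_le b YM zn'; rewrite b1 rdotNr lerNl.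
have ep0 : 0 < 1 - rdot y zeta.
  by rewrite subr_gt0; apply: le_lt_trans (rdot_le_norm _ zn) y1.
have key (mu : R) : c * (mu * sqmod (s - e)) <=
    mu ^+ 2 * sqmod (s - e) * (1 - rdot y zeta) + 2.
  pose lam : C := mu%:C * (s - e).
  have := maxball_le (col_mx (lam *: b) b) TfB zn.
  rewrite formvec_triangular !formvec_scalar colnormsq_col colnormsqZ b1.
  have -> : mxform 1%:M (lam *: b) (lam *: b) = (sqmod lam)%:C.
    by rewrite mxform1 colnormsqZ b1 mulr1.
  have -> : formvec Y (lam *: b) b - mxform 1%:M (lam *: b) b *: y =
      lam^* *: (formvec Y b b - y).
    rewrite mxformZl mxform1 b1 mulr1 scalerBr; congr (_ - _).
    by apply/rowP => j; rewrite !mxE mxformZl.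
  rewrite !rdotDl !rdotZl {3}/rdot hdotZl hdotBl -/s -/e.
  have -> : lam^* * (s - e) = (mu * sqmod (s - e))%:C.
    by rewrite /lam rmorphM /= conj_real_complex -mulrA mulrJ_sqmod rmorphM.
  rewrite /lam sqmodM sqmod_real /= mulr1 -/e.
  rewrite -[rdot (formvec Y b b) zeta]/(complex.Re s) -/(rdot y zeta).
  by move: YB => [_ hs]; lra.
have c2 : 0 <= c ^+ 2 * sqmod (s - e) by rewrite mulr_ge0 ?sqr_ge0 ?sqmod_ge0.
(* This [mu] is optimal: it maximizes the difference of the two terms containing [mu]. *)
have := key (c / (2 * (1 - rdot y zeta))).
move: (1 - rdot y zeta) ep0 (sqmod _) c2 => q q0 D c2.
have -> : c * (c / (2 * q) * D) = (c ^+ 2 * D) / (2 * q) by field; rewrite gt_eqF.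
have -> : (c / (2 * q)) ^+ 2 * D * q = (c ^+ 2 * D) / (4 * q) by field; rewrite gt_eqF.
move: (c ^+ 2 * D) c2 => S S0 h.
have : S / (4 * q) <= 2.
  have -> : S / (4 * q) = S / (2 * q) - S / (4 * q) by field; rewrite gt_eqF.
  by lra.
by rewrite ler_pdivrMr ?mulr_gt0 //; lra.
Qed.

End NcContraction.

(** * Numerical radius strictly below 1 for points of the matrix ball *)

Section UniformConvergence.
Context {R : realType} {d : nat}.
Local Notation C := R[i].
Local Notation Mx n := (mxtuple R d n).
Implicit Types (f : forall n, Mx n -> Mx n) (z w u zeta : 'rV[C]_d).

Lemma l2norm_le_of_rdot x r : (forall w, normsq w <= 1 -> rdot x w <= r) ->
  l2norm (x : 'rV[C]_d) <= r.
Proof. by move=> h; have [w [w1 <-]] := exists_rdot_eq_l2norm x; exact: h. Qed.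

Lemma colnormsq_trmx {n} (x : 'rV[C]_n) : colnormsq x^T = normsq x.
Proof. by rewrite normsq_sum; apply: eq_bigr => i _; rewrite mxE. Qed.

Lemma formvecDl {n} (X : Mx n) a a' b :
  formvec X (a + a') b = formvec X a b + formvec X a' b.
Proof. by apply/rowP => j; rewrite mxE mxformDl [RHS]mxE; congr (_ + _); rewrite mxE. Qed.

Lemma formvecDr {n} (X : Mx n) a b b' :
  formvec X a (b + b') = formvec X a b + formvec X a b'.
Proof. by apply/rowP => j; rewrite mxE mxformDr [RHS]mxE; congr (_ + _); rewrite mxE. Qed.

Lemma formvecZl {n} (X : Mx n) (t : R) a b :
  formvec X (t%:C *: a) b = t%:C *: formvec X a b.
Proof. by apply/rowP => j; rewrite mxE mxformZl conj_real_complex [RHS]mxE [in RHS]mxE. Qed.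

Lemma formvecZr {n} (X : Mx n) (t : R) a b :
  formvec X a (t%:C *: b) = t%:C *: formvec X a b.
Proof. by apply/rowP => j; rewrite mxE mxformZr [RHS]mxE [in RHS]mxE. Qed.

Lemma formvecZ {n} (X : Mx n) (t : R) v :
  formvec X (t%:C *: v) (t%:C *: v) = (t ^+ 2)%:C *: formvec X v v.
Proof. by rewrite formvecZl formvecZr scalerA -rmorphM. Qed.

Lemma col_unit {n} (v : 'cV[C]_n) : v != 0 -> exists (t : R) (u : 'cV[C]_n),
  [/\ v = t%:C *: u, colnormsq u = 1 & t ^+ 2 = colnormsq v].
Proof.
move=> v0; have v1 := colnormsq_gt0 v0.
exists (Num.sqrt (colnormsq v)), ((Num.sqrt (colnormsq v))^-1%:C *: v).
rewrite sqr_sqrtr ?(ltW v1) // scalerA -rmorphM mulfV ?sqrtr_eq0 -?ltNge //.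
rewrite (rmorph1 (real_complex R)) scale1r colnormsqZ sqmod_real exprVn.
by rewrite sqr_sqrtr ?(ltW v1) // mulVf ?gt_eqF.
Qed.

Lemma maxball_formvec_lt {n} (X : Mx n) v : maxball n X -> v != 0 ->
  l2norm (formvec X v v) < colnormsq v.
Proof.
move=> /maxballP XB v0; have [w [w1 <-]] := exists_rdot_eq_l2norm (formvec X v v).
exact: XB.
Qed.

Lemma maxball_numerical_bound1 {n} (X : Mx n) : maxball n X -> numerical_bound 1 X.
Proof. by move=> XB v; apply: l2norm_le_of_rdot => w w1; rewrite mul1r maxball_le. Qed.

Lemma rdot_comb3_le (s : R) (p q r w : 'rV[C]_d) : 0 < s <= 1 ->
  rdot p w <= 2 -> rdot q w <= 2 -> rdot r w <= 2 ->
  rdot (s%:C *: p + s%:C *: q + (s ^+ 2)%:C *: r) w <= 6 * s.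
Proof.
move=> /andP[s0 s1] hp hq hr; rewrite rdotDl rdotDl rdotZl rdotZl rdotZl.
have c1 : s * rdot p w <= s * 2 by rewrite ler_wpM2l // ltW.
have c2 : s * rdot q w <= s * 2 by rewrite ler_wpM2l // ltW.
have c3 : s ^+ 2 * rdot r w <= s ^+ 2 * 2 by rewrite ler_wpM2l ?sqr_ge0.
have ss : s ^+ 2 <= s by rewrite expr2 ler_piMl // ltW.
by lra.
Qed.

(** Write [u = y + s h] with [|h| <= 1]: two terms of order [s] and one of order [s^2] remain, each
    form being at most 2. *)
Lemma formvec_near {n} (X : Mx n) (u y : 'cV[C]_n) (s : R) : numerical_bound 1 X ->
  colnormsq y <= 1 -> 0 < s <= 1 -> colnormsq (u - y) <= s ^+ 2 ->
  l2norm (formvec X u u - formvec X y y) <= 6 * s.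
Proof.
move=> X1 y1 s01 hs; have /andP[s0 s1] := s01; apply: l2norm_le_of_rdot => w w1.
have bnd (a b : 'cV[C]_n) : rdot (formvec X a b) w <= colnormsq a + colnormsq b.
  have := numerical_bound_form a b X1 w1; rewrite mul1r => h.
  apply: le_trans (ler_norm _) _; rewrite -lec_real.
  exact: le_trans (normc_ge_Re _) h.
have [h hE] : exists h, u - y = s%:C *: h.
  exists (s^-1%:C *: (u - y)); rewrite scalerA -rmorphM mulfV ?gt_eqF //.
  by rewrite (rmorph1 (real_complex R)) scale1r.
have h1 : colnormsq h <= 1.
  move: hs; rewrite hE colnormsqZ sqmod_real.
  by rewrite -[leRHS]mulr1 ler_pM2l // exprn_gt0.
have -> : formvec X u u - formvec X y y =
    s%:C *: formvec X h y + s%:C *: formvec X y h + (s ^+ 2)%:C *: formvec X h h.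
  have -> : u = y + s%:C *: h by rewrite -hE addrC subrK.
  rewrite formvecDl formvecDr formvecDr formvecZr formvecZl formvecZl formvecZr.
  rewrite scalerA -rmorphM -expr2 addrAC [formvec X y y + _]addrC addrK addrA.
  by rewrite (addrC (_ *: formvec X y h)).
have bnd2 (a b : 'cV[C]_n) : colnormsq a <= 1 -> colnormsq b <= 1 ->
    rdot (formvec X a b) w <= 2.
  by move=> a1 b1; apply: le_trans (bnd a b) _; exact: lerD a1 b1.
exact: rdot_comb3_le s01 (bnd2 _ _ h1 y1) (bnd2 _ _ y1 h1) (bnd2 _ _ h1 h1).
Qed.

(** Compactness of the unit sphere makes the strict inequalities uniform. Unit vectors are stored as
    rows to fit [l2_bolzano_weierstrass]. *)
Lemma maxball_exists_numerical_bound {n} (X : Mx n) : maxball n X ->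
  exists2 rho, 0 <= rho < 1 & numerical_bound rho X.
Proof.
move=> XB; apply: contrapT => no.
have r01 k : 0 <= (1 - k.+1%:R^-1 : R) < 1.
  by rewrite subr_ge0 invf_le1 ?ltr0n // ler1n /= gtrBl invr_gt0 ltr0n.
have /choice[x hx] : forall k : nat, exists x : 'rV[C]_n,
    normsq x = 1 /\ 1 - k.+1%:R^-1 < l2norm (formvec X x^T x^T).
  move=> k; apply: contrapT => no2; apply: no; exists (1 - k.+1%:R^-1) => // v.
  have [->|v0] := eqVneq v 0.
    rewrite colnormsq0 mulr0 (_ : formvec X 0 0 = 0) ?l2norm0 //.
    by apply/rowP => j; rewrite !mxE /mxform mulmx0 mxE.
  have [t [u [-> u1 _]]] := col_unit v0.
  rewrite formvecZ l2normZ ?sqr_ge0 // colnormsqZ sqmod_real u1 mulr1 mulrC.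
  rewrite ler_wpM2r ?sqr_ge0 // leNgt; apply/negP => hu; apply: no2.
  by exists u^T; rewrite trmxK -colnormsq_trmx trmxK.
have xn k : l2norm (x k) <= 1 by rewrite l2norm_le // (hx k).1 expr1n.
have [y [y1 cl]] := l2_bolzano_weierstrass xn.
have yn : normsq y <= 1 by rewrite -sqr_l2norm -(expr1n _ 2) ler_sqr ?nnegrE ?l2norm_ge0.
have X1 := maxball_numerical_bound1 XB.
have : 1 <= l2norm (formvec X y^T y^T).
  apply/ler_addgt0Pr => e e0; pose s := Num.min 1 (e / 12).
  have s0 : 0 < s by rewrite lt_min ltr01 divr_gt0.
  have s1 : s <= 1 by rewrite ge_min lexx.
  have se : s <= e / 12 by rewrite ge_min lexx orbT.
  have [N hN] := exists_nat_gt (2 / e).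
  have [k kN hk] := cl s s0 N.
  have hd : colnormsq ((x k)^T - y^T) <= s ^+ 2.
    by rewrite -linearB /= colnormsq_trmx -l2norm_le ?ltW.
  have s01 : 0 < s <= 1 by rewrite s0.
  have yn' : colnormsq y^T <= 1 by rewrite colnormsq_trmx.
  have arith (p q r t : R) : 1 - t < q -> q <= p + r -> r <= 6 * s -> t <= e / 2 ->
      1 <= p + e by lra.
  have ke : k.+1%:R^-1 <= e / 2.
    rewrite -[e / 2]invrK lef_pV2 ?posrE ?invr_gt0 ?divr_gt0 ?ltr0n //.
    rewrite invf_div; apply: le_trans (ltW hN) _.
    by rewrite ler_nat; apply: leq_trans kN _.
  apply: arith (hx k).2 (l2normB_le _ _) (formvec_near X1 yn' s01 hd) ke.
move=> h.
(* The bound [|y| <= 1] suffices: membership in the ball gives a value less than [|y|^2]. *)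
have y0 : y^T != 0.
  apply: contraTneq h => ->; rewrite -ltNge (_ : formvec X 0 0 = 0) ?l2norm0 ?ltr01 //.
  by apply/rowP => j; rewrite !mxE /mxform mulmx0 mxE.
have := maxball_formvec_lt XB y0; rewrite colnormsq_trmx => h2.
by have := le_lt_trans h h2; rewrite ltNge yn.
Qed.

Lemma mxform_le_entries {n} (A : 'M[C]_n) (eta : R) v : 0 <= eta ->
  (forall p q, `|A p q| <= eta%:C) ->
  `|mxform A v v| <= (n%:R * n%:R * eta * colnormsq v)%:C.
Proof.
move=> eta0 h; pose S := Num.sqrt (colnormsq v).
have S2 : S ^+ 2 = colnormsq v by rewrite sqr_sqrtr // colnormsq_ge0.
have S0 : 0 <= S by exact: sqrtr_ge0.
have vS p : `|v p 0| <= S%:C.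
  rewrite -(@ler_pXn2r _ 2) ?nnegrE ?normr_ge0 //; last by rewrite -[0]/(0%:C) lec_real.
  rewrite -sqmodE -rmorphXn lec_real S2 /colnormsq (bigD1 p) //= lerDl.
  by rewrite sumr_ge0 // => i _; exact: sqmod_ge0.
have term p q : `|(v p 0)^* * A p q * v q 0| <= (eta * colnormsq v)%:C.
  have -> : (eta * colnormsq v)%:C = S%:C * eta%:C * S%:C.
    by rewrite -!rmorphM /= -S2; congr (_%:C); ring.
  rewrite normrM normrM norm_conjC.
  by apply: ler_pM => //; apply: ler_pM.
have -> : mxform A v v = \sum_q \sum_p (v p 0)^* * A p q * v q 0.
  rewrite /mxform mxE; apply: eq_bigr => q _; rewrite mxE mulr_suml.
  by apply: eq_bigr => p _; rewrite !mxE.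
apply: le_trans (ler_norm_sum _ _ _) _.
apply: (@le_trans _ _ (\sum_(q < n) \sum_(p < n) (eta * colnormsq v)%:C)).
  apply: ler_sum => q _; apply: le_trans (ler_norm_sum _ _ _) _.
  by apply: ler_sum => p _; exact: term.
rewrite !sumr_const !card_ord -mulrnA -rmorphMn /= lec_real.
by rewrite -mulr_natl natrM mulrA.
Qed.

End UniformConvergence.

(** * Uniformity on compact sets and convergence at every level *)

Section Conclusion.
Context {R : realType} {d : nat}.
Local Notation C := R[i].
Local Notation Mx n := (mxtuple R d n).

Lemma ball_mxtupleP {n} (X Y : Mx n) (e : R) : 0 < e ->
  ball X e%:C Y <-> forall j p q, `|X 0 j p q - Y 0 j p q| < e%:C.
Proof.
move=> e0; have e0' : 0 < e%:C by rewrite ltc_real.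
split=> [[_ h] j p q|h]; first by have [_ /(_ p q)] := h 0 j.
by split=> // i j; split=> // p q; rewrite ord1; exact: h.
Qed.

Lemma numerical_bound_le {n} (rho rho' : R) (X : Mx n) : rho <= rho' ->
  numerical_bound rho X -> numerical_bound rho' X.
Proof.
move=> le XB v; apply: le_trans (XB v) _.
by rewrite ler_wpM2r // colnormsq_ge0.
Qed.

Lemma numerical_bound_near {n} (rho e : R) (X : Mx n) : 0 < e -> numerical_bound rho X ->
  exists2 eta, 0 < eta & forall Y, ball X eta%:C Y -> numerical_bound (rho + e) Y.
Proof.
move=> e0 XB; pose K : R := d%:R * (n%:R * n%:R) + 1.
have K0 : 0 < K by rewrite ltr_wpDl // !mulr_ge0.
pose eta := e / K; have eta0 : 0 < eta by rewrite divr_gt0.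
exists eta => // Y /(ball_mxtupleP _ _ eta0) XY v.
have v0 := colnormsq_ge0 v.
have E0 : 0 <= n%:R * n%:R * eta * colnormsq v.
  by rewrite mulr_ge0 // mulr_ge0 ?(ltW eta0) // mulr_ge0.
apply: le_trans (l2normB_le _ (formvec X v v)) _; rewrite mulrDl lerD //.
apply: (@le_trans _ _ (d%:R * (n%:R * n%:R * eta * colnormsq v))).
  apply: l2norm_le_coord => [//|j].
  have -> : (formvec Y v v - formvec X v v) 0 j = mxform (Y 0 j - X 0 j) v v.
    by rewrite mxformBm !mxE.
  rewrite -lec_real sqmodE rmorphXn /= ler_pXn2r ?nnegrE ?normr_ge0 //; last first.
    by rewrite -[0]/(0%:C) lec_real.
  apply: mxform_le_entries (ltW eta0) _ => p q; rewrite !mxE distrC; exact/ltW/XY.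
have -> : d%:R * (n%:R * n%:R * eta * colnormsq v) =
    (d%:R * (n%:R * n%:R) * eta) * colnormsq v by ring.
rewrite ler_wpM2r // /eta mulrA ler_pdivrMr // mulrC ler_wpM2l ?(ltW e0) //.
by rewrite lerDl.
Qed.

(** The bounds [1 - 1 / (k + 1)] increase with [k], and one of them holds near each point;
    compactness picks one for all of [K]. *)
Lemma compact_numerical_bound {n} (K : set (Mx n)) : compact K -> K `<=` maxball n ->
  exists2 rho : R, 0 <= rho < 1 & forall X, K X -> numerical_bound rho X.
Proof.
move=> /compact_near_coveringP Kc KB.
have r01 (k : nat) : 0 <= (1 - k.+1%:R^-1 : R) < 1.
  by rewrite subr_ge0 invf_le1 ?ltr0n // ler1n /= gtrBl invr_gt0 ltr0n.
have := Kc nat \oo (fun k X => numerical_bound (1 - k.+1%:R^-1) X) _.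
case=> [X KX|N _ hN].
  have [rho /andP[rho0 rho1] XB] := maxball_exists_numerical_bound (KB X KX).
  (* Half the gap: [rho + e = 1 - e], which is at most [1 - 1 / (k + 1)] for large [k]. *)
  pose e := (1 - rho) / 2; have e0 : 0 < e by rewrite divr_gt0 // subr_gt0.
  have [eta eta0 XY] := numerical_bound_near e0 XB.
  have [N hN] := exists_nat_gt e^-1.
  exists (ball X eta%:C, [set k | (N <= k)%N]) => /=.
    by split; [apply: nbhsx_ballx; rewrite ltc_real | exists N].
  move=> [Y k] /= [YB Nk]; apply: numerical_bound_le (XY Y YB).
  have : k.+1%:R^-1 <= e.
    rewrite -[e]invrK lef_pV2 ?posrE ?invr_gt0 ?ltr0n //.
    by apply: le_trans (ltW hN) _; rewrite ler_nat; apply: leq_trans Nk _.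
  by rewrite /e /=; move: (_^-1) => x; lra.
exists (1 - N.+1%:R^-1); first exact: r01.
by move=> X KX; apply: hN KX => /=.
Qed.

Lemma uniform_cvg_of_ball {U : choiceType} {V : pseudoMetricType C} (K : set U)
    (F : nat -> U -> V) (g : U -> V) :
  (forall e : R, 0 < e -> exists N, forall k, (N <= k)%N ->
     forall x, K x -> ball (g x) e%:C (F k x)) ->
  {uniform K, F @ \oo --> g}.
Proof.
move=> h P /uniform_nbhs[E []]; rewrite -entourage_ballE.
move=> [_ /= /gt0_complex[e e0 ->] eE] EP.
have [N hN] := h e e0.
by exists N => // k /= Nk; apply: EP => x Kx; apply: eE; exact: hN.
Qed.

Lemma ball_of_uniform_cvg {U : choiceType} {V : pseudoMetricType C} (K : set U)
    (F : nat -> U -> V) (g : U -> V) (e : R) : 0 < e ->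
  {uniform K, F @ \oo --> g} -> exists N, forall k, (N <= k)%N ->
    forall x, K x -> ball (g x) e%:C (F k x).
Proof.
move=> e0 h.
have [|N _ hN] := h [set h | forall x, K x -> ball (g x) e%:C (h x)].
  apply/uniform_nbhs; exists [set xy | ball xy.1 e%:C xy.2]; split.
    by rewrite -entourage_ballE; exists e%:C => //=; rewrite ltc_real.
  by move=> h' /= hh' x Kx; exact: hh'.
by exists N => k Nk; exact: hN k Nk.
Qed.

Lemma mxform_delta {n} (A : 'M[C]_n) p q :
  mxform A (delta_mx p 0) (delta_mx q 0) = A p q.
Proof.
rewrite /mxform -colE.
rewrite (_ : delta_mx p 0 ^t* = delta_mx 0 p) -?rowE ?mxE //.
by apply/matrixP => i j; rewrite !mxE rmorph_nat andbC.
Qed.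

Lemma colnormsq_delta {n} (p : 'I_n) : colnormsq (delta_mx p 0 : 'cV[C]_n) = 1.
Proof.
rewrite /colnormsq (bigD1 p) //= big1 ?addr0 => [|i ip].
  by rewrite mxE !eqxx -[_%:R]/(1%:C) sqmod_real expr1n.
by rewrite mxE (negPf ip) -[_%:R]/(0%:C) sqmod_real expr0n.
Qed.

(** As both vectors have norm at most 1, the squared distance is at most [2 (1 - rdot x zeta)]. The
    Harnack inequality compares [rdot x zeta] with the value at the centre 0. *)
Lemma formvec_cvg (f : forall n, Mx n -> Mx n) n rho (X : Mx n) zeta (delta : R) u :
  nc_self_map f -> (0 < n)%N -> 0 <= rho < 1 -> numerical_bound rho X ->
  l2norm zeta = 1 -> l2norm (level1 f 0 - zeta) <= delta -> colnormsq u = 1 ->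
  normsq (formvec (f n X) u u - zeta) <=
    2 * (delta + Num.sqrt (8 * delta) / ((1 - rho) / 2)).
Proof.
move=> f_nc n0 rho01 XB zn yz u1.
have /andP[rho0 rho1] := rho01.
have zn1 : normsq zeta <= 1 by rewrite -sqr_l2norm zn expr1n.
have := nc_harnack f_nc n0 rho01 XB zn1 u1.
have fXB : maxball n (f n X).
  by have [fB _ _] := f_nc; apply: (fB _ _ n0); exact: numerical_bound_maxball XB.
have := maxball_numerical_bound1 fXB u; rewrite mul1r u1.
move: (formvec (f n X) u u) (level1 f 0) yz => x y yz x1.
set c := (1 - rho) / 2; have c0 : 0 < c by rewrite divr_gt0 // subr_gt0.
have hy : 1 - rdot y zeta <= delta.
  have -> : 1 - rdot y zeta = rdot (zeta - y) zeta.
    by rewrite rdotBl -/(normsq zeta) -sqr_l2norm zn expr1n.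
  by apply: le_trans (rdot_le_norm _ zn1) _; rewrite l2distC.
move=> h.
have h1 : rdot y zeta - rdot x zeta <= Num.sqrt (8 * delta) / c.
  rewrite ler_pdivlMr // [leLHS]mulrC.
  apply: le_trans (ler_norm _) _; rewrite -sqrtr_sqr; apply: ler_wsqrtr.
  have := sqr_Re_le_sqmod (hdot x zeta - hdot y zeta).
  rewrite complex_ReD complex_ReN -/(rdot x zeta) -/(rdot y zeta) => h2.
  rewrite exprMn -[rdot y zeta - _]opprB sqrrN.
  apply: le_trans (_ : c ^+ 2 * sqmod (hdot x zeta - hdot y zeta) <= _).
    by rewrite ler_wpM2l ?sqr_ge0.
  by apply: le_trans h _; rewrite ler_wpM2l.
rewrite normsqB -!sqr_l2norm zn expr1n.
have x2 : l2norm x ^+ 2 <= 1 by rewrite -(expr1n _ 2) ler_sqr ?nnegrE ?l2norm_ge0.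
by lra.
Qed.

(** The index [N] depends only on [rho] and [e], not on the level or the point; this gives
    uniformity on compact sets. *)
Lemma nc_iter_cvg (f : forall n, Mx n -> Mx n) zeta rho e : nc_self_map f ->
  l2norm zeta = 1 -> 0 <= rho < 1 -> 0 < e ->
  (forall e, 0 < e -> exists N, forall k, (N <= k)%N ->
     l2norm (iter k (level1 f) 0 - zeta) <= e) ->
  exists N, forall k, (N <= k)%N -> forall n X, (0 < n)%N -> numerical_bound rho X ->
    ball (scalar_mxtuple n zeta) e%:C (iter k (f n) X).
Proof.
move=> f_nc zn rho01 e0 cvg0; have /andP[rho0 rho1] := rho01.
set c := (1 - rho) / 2; have c0 : 0 < c by rewrite divr_gt0 // subr_gt0.
(* Chosen so that the bound of [formvec_cvg] is at most [4 eta = (e / 4)^2]. *)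
pose eta := e ^+ 2 / 64; have eta0 : 0 < eta by rewrite divr_gt0 ?exprn_gt0.
pose delta := Num.min eta ((c * eta) ^+ 2 / 8).
have delta0 : 0 < delta by rewrite lt_min eta0 divr_gt0 // exprn_gt0 // mulr_gt0.
have d1 : delta <= eta by rewrite ge_min lexx.
have d2 : delta <= (c * eta) ^+ 2 / 8 by rewrite ge_min lexx orbT.
have dsq : Num.sqrt (8 * delta) / c <= eta.
  rewrite ler_pdivrMr // [leRHS]mulrC.
  have -> : c * eta = Num.sqrt ((c * eta) ^+ 2) by rewrite sqrtr_sqr gtr0_norm // mulr_gt0.
  by apply: ler_wsqrtr; lra.
have [N hN] := cvg0 delta delta0; exists N => k Nk n X n0 XB.
have g_nc := nc_self_map_iter k f_nc.
have yk : l2norm (level1 (fun n => iter k (f n)) 0 - zeta) <= delta.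
  by rewrite level1_iter; exact: hN.
have near u : colnormsq u = 1 -> normsq (formvec (iter k (f n) X) u u - zeta) <= (e / 4) ^+ 2.
  move=> u1; apply: le_trans (formvec_cvg g_nc n0 rho01 XB zn yk u1) _.
  rewrite -/c; have -> : (e / 4) ^+ 2 = 2 * (eta + eta) by rewrite /eta; field.
  by rewrite ler_wpM2l // lerD.
move: (iter k (f n) X) near => Y near.
apply/ball_mxtupleP => // j p q; rewrite distrC mxE.
set A := Y 0 j - (zeta 0 j)%:M.
have -> : Y 0 j p q - (zeta 0 j)%:M p q = A p q by rewrite /A !mxE.
have Av v : `|mxform A v v| <= (e / 4 * colnormsq v)%:C.
  have [->|v0] := eqVneq v 0.
    by rewrite /mxform mulmx0 mxE normr0 colnormsq0 mulr0.
  have [t [u [-> u1 _]]] := col_unit v0.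
  rewrite colnormsqZ sqmod_real u1 mulr1 mxformZl mxformZr conj_real_complex mulrA.
  rewrite -rmorphM -expr2 normrM.
  have -> : (e / 4 * t ^+ 2)%:C = (t ^+ 2)%:C * (e / 4)%:C by rewrite -rmorphM mulrC.
  have -> : `|(t ^+ 2)%:C| = (t ^+ 2)%:C :> C.
    by rewrite ger0_norm // -[0]/(0%:C) lec_real sqr_ge0.
  rewrite ler_wpM2l //; first by rewrite -[0]/(0%:C) lec_real sqr_ge0.
  have -> : mxform A u u = (formvec Y u u - zeta) 0 j.
    by rewrite /A mxformBm mxform_scalar mxform1 u1 mulr1 !mxE.
  rewrite -(@ler_pXn2r _ 2) ?nnegrE ?normr_ge0 //; last first.
    by rewrite -[0]/(0%:C) lec_real divr_ge0 // ltW.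
  rewrite -sqmodE -rmorphXn lec_real.
  by apply: le_trans (sqmod_le_normsq _ j) _; exact: near.
(* Entries are off-diagonal values on basis vectors; polarization doubles the bound [e / 4]. *)
rewrite -mxform_delta.
apply: le_lt_trans (mxform_numerical_radius (delta_mx p 0) (delta_mx q 0) Av) _.
by rewrite !colnormsq_delta ltc_real; lra.
Qed.

Lemma continuous_scalar_mxtuple1 : continuous (@scalar_mxtuple R d 1).
Proof.
move=> z U /nbhs_ballP[_ /= /gt0_complex[e e0 ->]] eU.
apply/nbhs_ballP; exists e%:C => /=; first by rewrite ltc_real.
move=> w [_ zw]; apply: eU; apply/ball_mxtupleP => // j p q.
by rewrite !mxE !ord1 eqxx !mulr1n; exact: zw.
Qed.

(** The compact set containing only 0 already determines the limit. *)
Lemma iterates_cvg_unique (g : 'rV[C]_d -> 'rV[C]_d) zeta zeta' :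
  iterates_cvg_to_boundary g zeta -> iterates_cvg_to_boundary g zeta' -> zeta = zeta'.
Proof.
move=> [_ h1] [_ h2]; apply: subr0_eq; apply: (@l2norm_eq0_eps _ _ _ (2 * d%:R)) => e e0.
have K0 : compact [set (0 : 'rV[C]_d)] by exact: compact_set1.
have KB : [set (0 : 'rV[C]_d)] `<=` unit_ball.
  by move=> _ ->; rewrite /unit_ball /= enormE l2norm0 -[1]/(1%:C) ltc_real ltr01.
have [N1 hN1] := ball_of_uniform_cvg e0 (h1 _ K0 KB).
have [N2 hN2] := ball_of_uniform_cvg e0 (h2 _ K0 KB).
have := hN1 (maxn N1 N2) (leq_maxl _ _) 0 erefl.
have := hN2 (maxn N1 N2) (leq_maxr _ _) 0 erefl.
move: (iter _ g 0) => y /(ball_rV_l2norm e0) b2 /(ball_rV_l2norm e0) b1.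
have := l2dist_triangle zeta y zeta'; rewrite [l2norm (y - _)]l2distC; lra.
Qed.

End Conclusion.

Unset Implicit Arguments.

Theorem corollary4p8 (R : realType) (d : nat)
    (f : forall n : nat, mxtuple R d n -> mxtuple R d n)
    (f_nc : nc_self_map f)
    (f_no_fixpoint : forall (n : nat) (X : mxtuple R d n),
       (0 < n)%N -> maxball n X -> f n X <> X) :
  exists zeta : 'rV[R[i]]_d,
    [/\ unit_sphere zeta,
        denjoy_wolff_point (level1 f) zeta
      & forall (n : nat) (K : set (mxtuple R d n)),
          (0 < n)%N -> compact K -> K `<=` maxball n ->
          {uniform K, (fun k : nat => iter k (f n)) @ \oo -->
                      (fun=> scalar_mxtuple n zeta)}].
Proof.
have FC := contractive_level1 f_nc.
have nofix z : l2norm z < 1 -> level1 f z <> z.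
  move=> z1 fz; apply: (f_no_fixpoint 1%N (scalar_mxtuple 1 z) isT).
    exact: scalar_mxtuple_maxball.
  by rewrite -level1E fz.
have [zeta zn cvg0] := iter0_cvg FC nofix.
have zS : unit_sphere zeta by rewrite /unit_sphere /= enormE zn.
have cvgK n (K : set (mxtuple R d n)) (e : R) : (0 < n)%N -> compact K ->
    K `<=` maxball n -> 0 < e -> exists N, forall k, (N <= k)%N -> forall X, K X ->
    ball (scalar_mxtuple n zeta) e%:C (iter k (f n) X).
  move=> n0 Kc KB e0; have [rho rho01 KX] := compact_numerical_bound Kc KB.
  have [N hN] := nc_iter_cvg f_nc zn rho01 e0 cvg0; exists N => k Nk X XK.
  exact: hN k Nk n X n0 (KX X XK).
(* The convergence in the ball is the case [n = 1] of [cvgK], transported by the embedding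
   [scalar_mxtuple 1]. *)
have cvg1 : iterates_cvg_to_boundary (level1 f) zeta.
  split=> // K Kc KB; apply: uniform_cvg_of_ball => e e0.
  have Kc' : compact (scalar_mxtuple 1 @` K).
    apply: continuous_compact Kc.
    exact/continuous_subspaceT/continuous_scalar_mxtuple1.
  have KB' : scalar_mxtuple 1 @` K `<=` maxball 1.
    move=> _ [z /KB zB <-]; apply: scalar_mxtuple_maxball.
    by move: zB; rewrite /unit_ball /= enormE -[1]/(1%:C) ltc_real.
  have [N hN] := cvgK 1%N _ e isT Kc' KB' e0; exists N => k Nk z Kz.
  have := hN k Nk _ (imageP _ Kz).
  have := level1E (fun n => iter k (f n)) z; rewrite level1_iter /= => <-.
  move=> /(ball_mxtupleP _ _ e0) h; split=> [|i j]; first by rewrite ltc_real.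
  by have := h j 0 0; rewrite !mxE !eqxx !mulr1n ord1.
exists zeta; split=> //.
  split=> // zeta'; exact: iterates_cvg_unique.
by move=> n K n0 Kc KB; apply: uniform_cvg_of_ball => e e0; exact: cvgK.
Qed.
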